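(* Let $\{X_n\}_{n=1}^\infty$ be a sequence of bounded IID random variables under the sub-linear expectation $\mathbb{E}$ (notation as in the context) such that (A.1) $\mathbb{E}[X_1]=\mathcal{E}[X_1]=0$; (A.2) $\mathbb{E}[X_1^2]=\overline{\sigma}^2$ and $\mathcal{E}[X_1^2]=\underline{\sigma}^2$, where $0<\underline{\sigma}\le\overline{\sigma}<\infty$. Let $S_n=\sum_{i=1}^n X_i$. Then: (I) $v\left(\underline{\sigma}\le\limsup_{n\to\infty}\frac{S_n}{\sqrt{2n\log\log n}}\le\overline{\sigma}\right)=1$; (II) $v\left(-\overline{\sigma}\le\liminf_{n\to\infty}\frac{S_n}{\sqrt{2n\log\log n}}\le-\underline{\sigma}\right)=1$; (III) writing $C(\{x_n\})$ for the cluster set (set of limit points in $\mathbb{R}$) of a real sequence $\{x_n\}$, $$v\left(C\left(\left\{\frac{S_n}{\sqrt{2n\log\log n}}\right\}\right)\setminus\left\{\limsup_{n\to\infty}\frac{S_n}{\sqrt{2n\log\log n}},\ \liminf_{n\to\infty}\frac{S_n}{\sqrt{2n\log\log n}}\right\}=(-\underline{\sigma},\underline{\sigma})\right)=1.$$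
   Context: Let $(\Omega,\mathcal{F})$ be a measurable space, $\mathcal{P}$ a nonempty set of probability measures on it, and $\mathcal{H}$ the set of real random variables on $(\Omega,\mathcal{F})$ considered. For $\xi\in\mathcal{H}$ define $\mathbb{E}[\xi]:=\sup_{P\in\mathcal{P}}E_P[\xi]$ and $\mathcal{E}[\xi]:=\inf_{P\in\mathcal{P}}E_P[\xi]$ (so $\mathcal{E}[\xi]=-\mathbb{E}[-\xi]$), and the capacities $\mathbb{V}(A):=\sup_{P\in\mathcal{P}}P(A)$, $v(A):=\inf_{P\in\mathcal{P}}P(A)$ for $A\in\mathcal{F}$. Standing assumption: $\mathbb{V}$ and $v$ are continuous capacities, i.e. each $V\in\{\mathbb{V},v\}$ satisfies $V(\emptyset)=0$, $V(\Omega)=1$, $V(A)\le V(B)$ for $A\subset B$, $V(A_n)\uparrow V(A)$ whenever $A_n\uparrow A$, and $V(A_n)\downarrow V(A)$ whenever $A_n\downarrow A$. Independence (Peng): a random variable $Y_n$ is independent of $X=(Y_1,\dots,Y_{n-1})$ under $\mathbb{E}$ if for every measurable $\varphi$ on $\mathbb{R}^n$ (with the relevant quantities in $\mathcal{H}$), $\mathbb{E}[\varphi(X,Y_n)]=\mathbb{E}[\overline{\varphi}(X)]$ where $\overline{\varphi}(x):=\mathbb{E}[\varphi(x,Y_n)]$. Identical distribution: $X\overset{d}{=}Y$ if $\mathbb{E}[\varphi(X)]=\mathbb{E}[\varphi(Y)]$ for every measurable $\varphi$ with $\varphi(X),\varphi(Y)\in\mathcal{H}$. A sequence $\{X_i\}$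 is IID if $X_i\overset{d}{=}X_1$ for all $i$ and $X_{i+1}$ is independent of $(X_1,\dots,X_i)$ for each $i\ge1$. Here $\log$ is the natural logarithm. *)

(* Defs.v *)
From HB Require Import structures.
From mathcomp Require Import all_boot all_order all_algebra.
From mathcomp Require Import all_classical all_reals all_analysis.
Set Implicit Arguments. Unset Strict Implicit. Unset Printing Implicit Defensive.
Import Order.TTheory GRing.Theory Num.Theory.
Local Open Scope classical_set_scope.
Local Open Scope ring_scope.

(* Sub-linear expectation framework (Peng) over a nonempty set Ps of
   probability measures on a measurable space T.  The space H of random
   variables considered is the space of bounded measurable real functions. *)
Section SublinearExpectation.
Context {R : realType} {d : measure_display} {T : measurableType d}.
Variable Ps : set (probability T R).

Definition upE (xi : T -> R) : \bar R :=
  ereal_sup [set (\int[P]_w (xi w)%:E)%E | P in Ps].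
Definition loE (xi : T -> R) : \bar R :=
  ereal_inf [set (\int[P]_w (xi w)%:E)%E | P in Ps].
Definition upV (A : set T) : \bar R := ereal_sup [set P A | P in Ps].
Definition lov (A : set T) : \bar R := ereal_inf [set P A | P in Ps].

Definition inH (xi : T -> R) : Prop :=
  measurable_fun setT xi /\ exists M : R, forall w, `|xi w| <= M.

Definition continuous_capacity (V : set T -> \bar R) : Prop :=
  (forall A : (set T)^nat, (forall n, measurable (A n)) ->
     {homo A : n m / (n <= m)%N >-> n `<=` m} ->
     V (A n) @[n --> \oo] --> V (\bigcup_n A n)) /\
  (forall A : (set T)^nat, (forall n, measurable (A n)) ->
     {homo A : n m / (n <= m)%N >-> m `<=` n} ->
     V (A n) @[n --> \oo] --> V (\bigcap_n A n)).

Definition ident_distr (X Y : T -> R) : Prop :=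
  forall phi : R -> R, measurable_fun setT phi ->
    inH (phi \o X) -> inH (phi \o Y) -> upE (phi \o X) = upE (phi \o Y).

(* Peng independence: Y is independent of the vector X = (Y_1,..,Y_{n-1})
   (valued in n.-tuple R with its product sigma-algebra) *)
Definition indep_of (n : nat) (X : T -> n.-tuple R) (Y : T -> R) : Prop :=
  forall phi : n.-tuple R * R -> R, measurable_fun setT phi ->
    inH (fun w => phi (X w, Y w)) ->
    (forall x, inH (fun w => phi (x, Y w))) ->
    let phibar := fun x => fine (upE (fun w => phi (x, Y w))) in
    inH (phibar \o X) ->
    upE (fun w => phi (X w, Y w)) = upE (phibar \o X).

(* IID sequence; X 0, X 1, ... stand for X_1, X_2, ... *)
Definition iid (X : nat -> T -> R) : Prop :=
  (forall i, ident_distr (X i) (X 0)) /\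
  (forall i, (0 < i)%N -> indep_of (fun w => [tuple X j w | j < i]) (X i)).

End SublinearExpectation.

Definition lil_norm {R : realType} {T : Type} (X : nat -> T -> R) (n : nat) (w : T) : R :=
  (\sum_(i < n) X i w) / Num.sqrt (2 * n%:R * ln (ln n%:R)).

(* Main.v *)
Require Import Defs.
From HB Require Import structures.
From mathcomp Require Import all_boot all_order all_algebra.
From mathcomp Require Import all_classical all_reals all_analysis.
From mathcomp Require Import measurable_realfun.
From mathcomp Require Import ring lra.
Set Implicit Arguments. Unset Strict Implicit. Unset Printing Implicit Defensive.
Import Order.TTheory GRing.Theory Num.Theory.
Import numFieldNormedType.Exports.
Local Open Scope classical_set_scope.
Local Open Scope ring_scope.

(* A capacity [upV] that is continuous from above leaves no room for ambiguity
   in an IID sequence: if the upper and lower means of [f (X 0)] differed, Peng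
   independence would produce infinitely many disjoint events of upper
   probability at least 1/4.  Hence both variances agree, say with [s ^+ 2].

   Peng independence applied to [g (x) * (h (y) - upE h)] shows that, under
   every single measure [P] of the family, the conditional expectation of
   [h (X m)] given the past lies between the lower and the upper expectation of
   [h (X 0)].  For exponentials this pins the conditional moment generating
   functions down to those of a Gaussian, up to [1 +- eta] in the exponent, and
   the law of the iterated logarithm holds [P]-almost surely: the upper half by
   a maximal inequality for exponential supermartingales and Borel-Cantelli
   along geometric blocks, the lower half by exponential tilting on the blocks
   [q^k, q^(k+1)).  So limsup and liminf are exactly [s] and [-s], and as the
   increments of the normalized sums vanish, the cluster set is [-s, s]. *)

(** [lov] of a measurable event is 1 as soon as every P of the family gives it probability 1, so
    once the variances agree everything is argued under one fixed P. Peng independence speaks of the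
    supremum over the family; for a single P it is exploited through inequalities between integrals
    against nonnegative bounded weights [G] of the past. These stand in for conditional expectations
    throughout: [G] carries in turn exponentials of earlier increments, the indicator that a process
    has stayed below a level, and the indicator that earlier blocks have failed. In the degeneracy
    step the measure that favours small values up to a block and large ones on it is never
    constructed: the event is minorized by a Chernoff expression whose upper expectation is computed
    exactly, factor by factor. The blocks double in length, which makes the Chernoff errors r^(2^k)
    summable. In the lower half the tilt on block k is calibrated so that the block succeeds with
    conditional probability at least 1/(2k), the borderline of divergence; the product of the
    failure bounds then tends to 0 and replaces the second Borel-Cantelli lemma. *)

Section ExponentialBounds.
Context {R : realType}.
Implicit Types x : R.

(** Since [expR x * (1 - x) <= 1], it suffices that (1 + x + 2x^2)(1 - x) = 1 + x^2 (1 - 2x) is at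
    least 1, which is where x <= 1/2 enters. *)
Lemma expR_le_quadratic x : `|x| <= 2^-1 -> expR x <= 1 + x + 2 * x ^+ 2.
Proof.
rewrite ler_norml => /andP[x1 x2].
have h := expR_ge1Dx (- x).
have e0 := expR_gt0 x.
have : expR x * (1 - x) <= 1.
  by rewrite -[leRHS](expRxMexpNx_1 x) ler_pM2l.
have h2 : 1 <= (1 + x + 2 * x ^+ 2) * (1 - x) by nra.
move=> h3; have : expR x * (1 - x) <= (1 + x + 2 * x ^+ 2) * (1 - x) by lra.
by rewrite ler_pM2r//; lra.
Qed.

(** The remainder [g] vanishes at 0 and its derivative e^y - 1 - y lies between 0 and 2y^2 by the
    previous bound; the mean value theorem supplies the third factor |x|. *)
Lemma expR_taylor2 x : `|x| <= 2^-1 ->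
  `|expR x - (1 + x + x ^+ 2 / 2)| <= 2 * `|x| ^+ 3.
Proof.
move=> xh.
pose g (y : R) := expR y - (1 + y + y ^+ 2 / 2).
pose dg (y : R) := expR y - (1 + y).
have dgE (y : R) : is_derive y 1 g (dg y).
  rewrite /g /dg; apply: is_derive_eq.
  rewrite /GRing.scale /=; lra.
have dgb c : `|c| <= `|x| -> `|dg c| <= 2 * `|x| ^+ 2.
  move=> cx; rewrite /dg ger0_norm ?subr_ge0 ?expR_ge1Dx//.
  have := expR_le_quadratic (le_trans cx xh).
  have : c ^+ 2 <= `|x| ^+ 2 by rewrite -(real_normK (num_real c)) lerXn2r// nnegrE.
  lra.
have cg : continuous g.
  by move=> y; apply: differentiable_continuous; apply/derivable1_diffP; have [] := dgE y.
have g0 : g 0 = 0 by rewrite /g expR0; lra.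
suff [c cx gx] : exists2 c, `|c| <= `|x| & g x = dg c * x.
  rewrite -/(g x) gx normrM (_ : 2 * `|x| ^+ 3 = 2 * `|x| ^+ 2 * `|x|); last by ring.
  by rewrite ler_wpM2r// dgb.
have [x0|x0|->] := ltgtP x 0; last by exists 0; rewrite // g0 mulr0.
- have [|c] := @MVT R g dg _ _ x0 (fun y _ => dgE y).
    exact/continuous_subspaceT/cg.
  rewrite in_itv/= => /andP[c1 c2]; rewrite g0 => e; exists c; last lra.
  by rewrite !ltr0_norm// lerN2 ltW.
- have [|c] := @MVT R g dg _ _ x0 (fun y _ => dgE y).
    exact/continuous_subspaceT/cg.
  rewrite in_itv/= => /andP[c1 c2]; rewrite g0 => e; exists c; last lra.
  by rewrite !gtr0_norm// ltW.
Qed.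

End ExponentialBounds.

(** * Iterated logarithms, geometric blocks and the numerical constants of the two halves *)

Section RealEstimates.
Context {R : realType}.
Implicit Types x y t : R.

Lemma exists_expr_lt (r e : R) : 0 <= r < 1 -> 0 < e -> exists K, r ^+ K < e.
Proof.
move=> /andP[r0 r1] e0.
have /cvgrPdist_lt/(_ e e0) : (fun n => r ^+ n) @ \oo --> (0 : R).
  by apply: cvg_expr; rewrite ger0_norm.
case=> K _ /(_ K (leqnn K)); rewrite sub0r normrN ger0_norm ?exprn_ge0// => h.
by exists K.
Qed.

Lemma geometric_sum_le (r : R) m n : 0 <= r < 1 ->
  \sum_(m <= k < n) r ^+ k <= r ^+ m / (1 - r).
Proof.
move=> /andP[r0 r1]; have r1' : 0 < 1 - r by rewrite subr_gt0.
have [mn|/ltnW nm] := leqP m n; last first.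
  by rewrite big_geq// divr_ge0 ?exprn_ge0// ltW.
suff -> : \sum_(m <= k < n) r ^+ k = (r ^+ m - r ^+ n) / (1 - r).
  by rewrite ler_pM2r ?invr_gt0// gerBl exprn_ge0.
elim: n mn => [|n IH]; first by rewrite leqn0 => /eqP ->; rewrite big_geq// subrr mul0r.
rewrite leq_eqVlt => /predU1P[->|]; first by rewrite big_geq// subrr mul0r.
rewrite ltnS => mn; rewrite big_nat_recr//= IH// exprS.
by field; rewrite gt_eqF.
Qed.

Lemma exists_expr_gt (th x : R) : 1 < th -> exists k : nat, x < th ^+ k.
Proof.
move=> th1; have th0 : 0 < th by exact: lt_trans th1.
have y0 : 0 < `|x| + 1 by rewrite ltr_wpDl.
have th01 : 0 <= th^-1 < 1 by rewrite invr_ge0 ltW//= invf_lt1.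
have yV : 0 < (`|x| + 1)^-1 by rewrite invr_gt0.
have [K] := exists_expr_lt th01 yV.
rewrite exprVn ltf_pV2 ?posrE ?exprn_gt0// => h.
exists K; apply: le_lt_trans h; apply: le_trans (ler_norm x) _.
by rewrite lerDl.
Qed.

Lemma exists_block (th : R) (n : nat) : 1 < th -> (0 < n)%N ->
  exists k : nat, th ^+ k <= n%:R < th ^+ k.+1.
Proof.
move=> th1 n0.
have ex := exists_expr_gt n%:R th1.
case: (ex_minnP ex) => -[|k] nk kmin.
  by move: nk; rewrite expr0 ltrn1 ltnNge n0.
by exists k; rewrite nk andbT leNgt; apply/negP => /kmin; rewrite ltnn.
Qed.

Lemma le_lnln x y : 1 < x -> x <= y -> ln (ln x) <= ln (ln y).
Proof.
move=> x1 xy; have y1 : 1 < y by exact: lt_le_trans xy.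
by rewrite !ler_ln ?posrE ?ln_gt0 ?(lt_trans ltr01)// !ler_ln ?posrE ?(lt_trans ltr01).
Qed.

Lemma lnln_gt0 x : expR 1 < x -> 0 < ln (ln x).
Proof.
move=> x1; apply: ln_gt0; rewrite -{1}(expRK 1) ltr_ln ?posrE ?expR_gt0//.
exact: lt_trans (expR_gt0 _) x1.
Qed.

Lemma lnln_le_sqrt t : expR 1 < t -> ln (ln t) <= 2 * Num.sqrt t.
Proof.
move=> t1; have t0 : 0 < t by exact: lt_trans (expR_gt0 _) t1.
have l1 : 1 < ln t by rewrite -{1}(expRK 1) ltr_ln ?posrE ?expR_gt0.
apply: (@le_trans _ _ (ln t)); first by apply/ltW/ln_sublinear/(lt_trans ltr01).
have st0 : 0 < Num.sqrt t by rewrite sqrtr_gt0.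
have -> : ln t = 2 * ln (Num.sqrt t).
  by rewrite mulr_natl -lnXn// sqr_sqrtr// ltW.
by rewrite ler_pM2l//; exact/ltW/ln_sublinear.
Qed.

(** The square root is, up to the factor 1/s, the tilt used at scale t; this brings the tilt below
    the threshold [l0] of [nearly_gaussian]. *)
Lemma lil_rate_small (e : R) : 0 < e -> exists2 C : R, expR 1 < C &
  forall t, C <= t -> Num.sqrt (2 * ln (ln t) / t) <= e.
Proof.
(* As ln ln t <= 2 sqrt t, the quantity under the root is at most 4 / sqrt t, hence at most e^2 once
   sqrt t >= [c]. *)
move=> e0; pose c := 4 / e ^+ 2; have c0 : 0 < c by rewrite divr_gt0// exprn_gt0.
exists (expR 1 + 1 + c ^+ 2).
  by rewrite -addrA ltrDl ltr_wpDr// sqr_ge0.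
move=> t Ct.
have et : expR 1 < t.
  by apply: lt_le_trans Ct; rewrite -addrA ltrDl ltr_wpDr// sqr_ge0.
have t0 : 0 < t by exact: lt_trans (expR_gt0 _) et.
have st0 : 0 < Num.sqrt t by rewrite sqrtr_gt0.
have cst : c <= Num.sqrt t.
  rewrite -[leLHS](ger0_norm (ltW c0)) -sqrtr_sqr ler_sqrt; last exact: ltW.
  by apply: le_trans Ct; rewrite lerDr addr_ge0// expR_ge0.
rewrite -[leRHS](ger0_norm (ltW e0)) -sqrtr_sqr ler_sqrt ?sqr_ge0//.
rewrite ler_pdivrMr//; apply: (@le_trans _ _ (4 * Num.sqrt t)).
  by have := lnln_le_sqrt et; lra.
rewrite -{2}(sqr_sqrtr (ltW t0)) expr2 mulrA ler_pM2r//.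
by move: cst; rewrite /c ler_pdivrMr ?exprn_gt0// mulrC.
Qed.

Lemma lil_norm_ge t (n : nat) : expR 1 < t -> t <= n%:R ->
  Num.sqrt (2 * t * ln (ln t)) <= Num.sqrt (2 * n%:R * ln (ln n%:R)).
Proof.
move=> t1 tn; have t0 : 0 < t by exact: lt_trans (expR_gt0 _) t1.
have l0 := lnln_gt0 t1.
have ll : ln (ln t) <= ln (ln n%:R).
  by apply: le_lnln => //; apply: lt_trans t1; rewrite expR_gt1.
rewrite ler_sqrt; last by rewrite !mulr_ge0// ?ler0n// (le_trans (ltW l0)).
by apply: ler_pM => //; [rewrite mulr_ge0// ltW|exact: ltW|rewrite ler_pM2l].
Qed.

(* The telescoping bound behind the convergence of [\sum_k k^(-1-del)]; a power
   [x^y] is written [expR (y * ln x)]. *)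
Lemma telescope_power (del x : R) : 0 < del -> 0 < x ->
  del * expR (- (1 + del) * ln (x + 1)) <=
  expR (- del * ln x) - expR (- del * ln (x + 1)).
Proof.
move=> d0 x0; have x10 : 0 < x + 1 by rewrite addr_gt0.
have hln : (x + 1)^-1 <= ln (x + 1) - ln x.
  have := @le_ln1Dx _ (- (x + 1)^-1); rewrite ltrN2 invf_lt1// ltrDr x0 => /(_ isT).
  rewrite (_ : 1 - (x + 1)^-1 = x / (x + 1)); last by field; rewrite gt_eqF.
  by rewrite ln_div ?posrE//; lra.
have -> : expR (- del * ln x) = expR (- del * ln (x + 1)) * expR (del * (ln (x + 1) - ln x)).
  by rewrite -expRD; congr expR; ring.
have -> : expR (- (1 + del) * ln (x + 1)) = expR (- del * ln (x + 1)) / (x + 1).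
  rewrite (_ : - (1 + del) * _ = - del * ln (x + 1) - ln (x + 1)); last by ring.
  by rewrite expRB lnK ?posrE.
rewrite -{3}[expR (- del * ln (x + 1))]mulr1 -mulrBr mulrCA ler_pM2l ?expR_gt0//.
rewrite lerBrDl; apply: le_trans (expR_ge1Dx _).
by rewrite lerD2l ler_pM2l.
Qed.

(** Since ln (th^j) = j ln th, the terms are a constant times (k0 + k + 2)^(-1-del). The shift by 2
    makes the telescoping bound start at k0 + k + 1, which is positive. *)
Lemma summable_blocks (th del : R) (k0 : nat) : 1 < th -> 0 < del -> exists c : R,
  forall n, \sum_(0 <= k < n) expR (- (1 + del) * ln (ln (th ^+ (k0 + k).+2))) <= c.
Proof.
move=> th1 d0; have l0 : 0 < ln th by exact: ln_gt0.
pose c0 := expR (- (1 + del) * ln (ln th)).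
pose v (k : nat) := expR (- del * ln ((k0 + k).+1%:R : R)).
exists (c0 / del * v 0%N) => n.
have tm k : expR (- (1 + del) * ln (ln (th ^+ (k0 + k).+2))) <= c0 / del * (v k - v k.+1).
  rewrite lnXn ?(lt_trans ltr01)// -mulr_natl lnM ?posrE ?ltr0n//.
  rewrite mulrDr expRD mulrC -/c0 -mulrA ler_pM2l ?expR_gt0//.
  rewrite [leRHS]mulrC ler_pdivlMr// [leLHS]mulrC /v addnS -[(k0 + k).+2%:R]natr1.
  by apply: telescope_power => //; rewrite ltr0n.
apply: (@le_trans _ _ (c0 / del * (v 0%N - v n))).
  apply: (@le_trans _ _ (\sum_(0 <= k < n) (c0 / del * (v k - v k.+1)))).
    exact: ler_sum.
  rewrite -mulr_sumr; under eq_bigr do rewrite -opprB.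
  by rewrite sumrN telescope_sumr// opprB.
rewrite ler_pM2l ?divr_gt0 ?expR_gt0// gerBl expR_ge0//.
Qed.

Lemma nneseries_le (u : nat -> \bar R) (c : R) : (forall n, (0 <= u n)%E) ->
  (forall n, (\sum_(0 <= k < n) u k <= c%:E)%E) -> (\sum_(k <oo) u k < +oo)%E.
Proof.
move=> u0 uc; apply: (@le_lt_trans _ _ c%:E); last by rewrite ltry.
apply: lime_le; first exact: is_cvg_nneseries.
exact: nearW.
Qed.

(* Outside the window [(1 - del) x, (1 + del) x] the weight [exp y] is dominated
   by its tilts by [-del] and [+del], which carry little mass when [y] is nearly
   Gaussian with variance [x]: this yields Kolmogorov's lower exponential bound. *)
Lemma tilting_window (del x y : R) : 0 < del ->
  expR y <= expR ((1 + del) * x) * (1 - (y < (1 - del) * x)%R%:R) +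
    (expR (del * (1 - del) * x) * expR ((1 - del) * y) +
     expR (- (del * (1 + del) * x)) * expR ((1 + del) * y)).
Proof.
move=> d0; rewrite -!expRD.
have [h|h] := ltP y ((1 - del) * x).
  rewrite subrr mulr0 add0r; apply: ler_wpDr; first exact: expR_ge0.
  rewrite ler_expR; have : del * y <= del * ((1 - del) * x) by rewrite ler_pM2l// ltW.
  lra.
rewrite subr0 mulr1; have [h2|/ltW h2] := leP y ((1 + del) * x).
  by apply: ler_wpDr; [rewrite addr_ge0 ?expR_ge0|rewrite ler_expR].
apply: ler_wpDl; first exact: expR_ge0.
apply: ler_wpDl; first exact: expR_ge0.
rewrite ler_expR; have : del * ((1 + del) * x) <= del * y by rewrite ler_pM2l.
lra.
Qed.

(** Without [eta] both tilted exponents equal (1 - del^2)/2 times x, short of x/2 by (del^2/2) x.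
    The perturbations cost at most 2 [eta] x = (del^2/5) x altogether, so (del^2/4) x remains to
    spare. *)
Lemma tilting_exponents (del x : R) : 0 < del <= 4^-1 -> 4 * ln 4 / del ^+ 2 <= x ->
  let eta := del ^+ 2 / 10 in let e := expR ((1 - eta) * (x / 2)) in
  [/\ 0 < eta < 1,
      expR (del * (1 - del) * x) * expR ((1 + eta) * ((1 - del) ^+ 2 * x / 2)) <= 4^-1 * e,
      expR (- (del * (1 + del) * x)) * expR ((1 + eta) * ((1 + del) ^+ 2 * x / 2)) <= 4^-1 * e &
      expR ((1 + del) * x) * expR (- (1 + 4 * del) * (x / 2)) <= e].
Proof.
move=> /andP[d0 d4] + eta e.
have d1 : del ^+ 2 <= del by rewrite expr2 ler_piMl ?ltW//; lra.
have d20 : 0 < del ^+ 2 by rewrite exprn_gt0.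
rewrite ler_pdivrMr// => xd.
have ln4 : 0 < ln (4 : R) by apply: ln_gt0; lra.
have x0 : 0 <= x.
  by rewrite -(pmulr_lge0 _ d20); lra.
have e1 : (1 - del) ^+ 2 <= 1 by rewrite expr_le1//; lra.
have e2 : (1 + del) ^+ 2 <= 3 by rewrite expr2; nra.
have eta0 : 0 < eta by rewrite /eta; lra.
(* The lower bound on [x] says that (del^2/4) x >= ln 4: the spare exponent yields the factor
   1/4. *)
have small (c : R) : c <= (1 - eta) / 2 - del ^+ 2 / 4 -> expR (c * x) <= 4^-1 * e.
  move=> /(ler_wpM2r x0) h.
  apply: (@le_trans _ _ (expR (- ln 4 + (1 - eta) * (x / 2)))); last first.
    by rewrite expRD expRN lnK ?posrE.
  by rewrite ler_expR; lra.
split; first by rewrite eta0 /eta; lra.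
- rewrite -expRD.
  rewrite (_ : del * (1 - del) * x + (1 + eta) * ((1 - del) ^+ 2 * x / 2) =
    (del * (1 - del) + (1 + eta) * (1 - del) ^+ 2 / 2) * x); last by ring.
  apply: small.
  have : eta * (1 - del) ^+ 2 <= eta * 1 by rewrite ler_pM2l.
  by rewrite /eta; lra.
- rewrite -expRD.
  rewrite (_ : - (del * (1 + del) * x) + (1 + eta) * ((1 + del) ^+ 2 * x / 2) =
    (- (del * (1 + del)) + (1 + eta) * (1 + del) ^+ 2 / 2) * x); last by ring.
  apply: small.
  have : eta * (1 + del) ^+ 2 <= eta * 3 by rewrite ler_pM2l.
  by rewrite /eta; lra.
- rewrite -expRD ler_expR.
  have : eta * x <= del * x by rewrite ler_wpM2r// /eta; lra.
  have : 0 <= del * x by rewrite mulr_ge0// ltW.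
  lra.
Qed.

(** The two tails [b] and [c] take at most half of the tilted mass [e * I]; the other half must come
    from the event above the threshold, of mass [I - J], where the weight is at most [A]. *)
Lemma tilting_combine (e e' A I J M b c : R) : 0 < A -> 0 <= I ->
  e * I <= M -> M <= A * (I - J) + (b + c) -> b <= 4^-1 * e * I -> c <= 4^-1 * e * I ->
  A * e' <= e -> J <= (1 - 2^-1 * e') * I.
Proof.
move=> A0 I0 h1 h2 hb hc he.
have : A * (2^-1 * e' * I) <= A * (I - J).
  have : A * e' * I <= e * I by rewrite ler_wpM2r.
  lra.
rewrite ler_pM2l//; lra.
Qed.

(** Calibration of the tilt on the block of length [L] from q^k to q^(k+1). The choice of [x] makes
    (1 + 4 del) x / 2 equal to ln k, so the lower exponential bound becomes 1/(2k), and [a] is the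
    tilt for which the exponent a^2 s^2 L equals [x]. The last clause compares the resulting
    threshold with the normalizer at q^(k+1). *)
Lemma lower_block_scales (del l0 x0 s : R) (q : nat) :
  0 < s -> 0 < l0 -> 0 < del <= 9^-1 -> expR 1 < q%:R :> R -> q%:R^-1 <= del ->
  exists k1 : nat, forall k, (k1 <= k)%N ->
  let L : R := q%:R ^+ k * (q%:R - 1) in let x := 2 * ln k%:R / (1 + 4 * del) in
  let a := Num.sqrt (x / L) / s in
  [/\ (0 < k)%N, 0 < a, (1 + del) * a <= l0, x0 <= x /\ (a * s) ^+ 2 * L = x &
      (1 - 7 * del) * s * Num.sqrt (2 * q%:R ^+ k.+1 * ln (ln ((q%:R : R) ^+ k.+1))) <=
      (1 - del) * (a * s ^+ 2 * L)].
Proof.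
move=> s0 l00 /andP[d0 d9] eq qd; set Q : R := q%:R.
have Q1 : 1 < Q by apply: lt_trans eq; rewrite expR_gt1.
have Q0 : 0 < Q by exact: lt_trans Q1.
have Q2 : 2 <= Q by have := expR_ge1Dx (1 : R); move: eq; rewrite -/Q; lra.
have [C C1 HC] := lil_rate_small (divr_gt0 (mulr_gt0 l00 s0) (ltr0n R 2)).
have [kC kCP] := exists_expr_gt C Q1.
have lq := lnln_gt0 eq; rewrite -/Q in lq.
(* The summands force ln k above 1, above [x0], and above (1 + ln ln q)/del; the last one makes ln
   ln q^(k+1) at most ln k up to the factor 1 - del. *)
pose Lam := 1 + `|x0| + (1 + ln (ln Q)) / del.
exists (maxn kC (Num.truncn (expR Lam)).+1) => k; rewrite geq_max => /andP[kCk kL] L x a.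
have Lk : expR Lam < k%:R.
  by apply: lt_le_trans (truncnS_gt _) _; rewrite ler_nat.
have k0 : 0 < k%:R :> R by exact: lt_trans (expR_gt0 _) Lk.
have Lamk : Lam < ln k%:R by rewrite -[Lam]expRK ltr_ln ?posrE ?expR_gt0.
have Q10 : 0 < (1 + ln (ln Q)) / del by rewrite divr_gt0// addr_gt0.
have lk1 : 1 < ln k%:R :> R.
  by apply: le_lt_trans Lamk; rewrite /Lam -addrA lerDl addr_ge0// ltW.
have lkx : `|x0| <= ln k%:R.
  by apply/ltW/(le_lt_trans _ Lamk); rewrite /Lam; lra.
have lkd : 1 + ln (ln Q) <= del * ln k%:R.
  rewrite mulrC -ler_pdivrMr//; apply/ltW/(le_lt_trans _ Lamk).
  by rewrite /Lam; have := normr_ge0 x0; lra.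
set lk := ln k%:R in lk1 lkx lkd x a *; clear Lamk Lk Lam kL.
set t := Q ^+ k in L a *.
have t0 : 0 < t by rewrite exprn_gt0.
have lnQ : 0 < ln Q by exact: ln_gt0.
have lntE (j : nat) : (0 < j)%N -> ln (ln (Q ^+ j)) = ln j%:R + ln (ln Q).
  by move=> j0; rewrite lnXn// -[ln Q *+ j]mulr_natl lnM ?posrE ?ltr0n.
have kn0 : (0 < k)%N by rewrite -(ltr0n R).
have llt : lk <= ln (ln t) by rewrite lntE// lerDl ltW.
have Ct : C <= t.
  by apply/(le_trans (ltW kCP)); apply: ler_weXn2l => //; exact: ltW.
have L0 : 0 < L by rewrite mulr_gt0// subr_gt0.
have tL : t <= L by rewrite ler_peMr//; [exact: ltW|lra].
have d40 : 0 < 1 + 4 * del by lra.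
have x0' : 0 < x by rewrite divr_gt0//; lra.
have x2lk : x <= 2 * lk.
  by rewrite ler_pdivrMr// ler_peMr//; lra.
have xlk : lk <= x.
  rewrite ler_pdivlMr//.
  have : lk * (4 * del) <= lk * 1 by rewrite ler_pM2l; lra.
  lra.
have xL0 : 0 < x / L by rewrite divr_gt0.
have sq0 : 0 < Num.sqrt (x / L) by rewrite sqrtr_gt0.
have a0 : 0 < a by rewrite divr_gt0.
have al : a <= l0 / 2.
  rewrite ler_pdivrMr// [leRHS]mulrAC; apply: le_trans (HC t Ct).
  rewrite ler_sqrt; last by rewrite divr_ge0 ?ltW// mulr_gt0//; lra.
  apply: ler_pM => //; [exact: ltW|by rewrite invr_ge0 ltW|lra|].
  by rewrite lef_pV2.
split => //.
- have : (1 + del) * a <= 2 * a by rewrite ler_pM2r//; lra.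
  lra.
- split; first by apply: le_trans xlk; exact: le_trans (ler_norm _) lkx.
  by rewrite /a divfK ?gt_eqF// sqr_sqrtr ?ltW// divfK// gt_eqF.
rewrite (_ : a * s ^+ 2 * L = s * (Num.sqrt (x / L) * L)); last first.
  by rewrite /a; field; rewrite gt_eqF.
set f := Num.sqrt _ * L; set ph := Num.sqrt _.
suff h : (1 - 6 * del) * ph <= f.
  have ph0 : 0 <= ph by exact: sqrtr_ge0.
  have f0 : 0 <= f by rewrite mulr_ge0 ?sqrtr_ge0// ltW.
  rewrite [leLHS](_ : _ = s * ((1 - 7 * del) * ph)); last by ring.
  rewrite [leRHS](_ : _ = s * ((1 - del) * f)); last by ring.
  rewrite ler_pM2l//.
  have h' : (1 - del) * ((1 - 6 * del) * ph) <= (1 - del) * f by rewrite ler_pM2l//; lra.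
  have : 0 <= del * del * ph by rewrite !mulr_ge0// ltW.
  lra.
have f0 : 0 <= f by rewrite mulr_ge0 ?sqrtr_ge0// ltW.
have d60 : 0 <= 1 - 6 * del by lra.
rewrite -[leRHS](ger0_norm f0) -sqrtr_sqr -[leLHS]ger0_norm; last first.
  by rewrite mulr_ge0// sqrtr_ge0.
rewrite -sqrtr_sqr ler_sqrt ?sqr_ge0//.
set Lb := ln (ln (Q ^+ k.+1)) in ph *.
have LbE : Lb <= lk + 1 + ln (ln Q).
  rewrite /Lb lntE// lerD2r -natr1.
  have -> : k%:R + 1 = k%:R * (1 + k%:R^-1) :> R by field; rewrite gt_eqF.
  have kV : 0 < k%:R^-1 :> R by rewrite invr_gt0.
  rewrite lnM ?posrE// ?addr_gt0// lerD2l.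
  apply: (le_trans (le_ln1Dx _)); first by apply: lt_trans kV; lra.
  by rewrite invf_le1// ler1n.
have Lb0 : 0 < Lb by rewrite /Lb lntE// addr_gt0// ln_gt0// ltr1n ltnS.
have lkLb : (1 - del) * Lb <= lk.
  have : (1 - del) * Lb <= (1 - del) * (lk + 1 + ln (ln Q)) by rewrite ler_pM2l//; lra.
  have : 0 <= del * (1 + ln (ln Q)) by rewrite mulr_ge0 ?addr_ge0 ?ltW.
  lra.
have -> : f ^+ 2 = x * L.
  by rewrite /f exprMn sqr_sqrtr ?ltW// expr2 mulrA divfK// gt_eqF.
rewrite exprMn /ph sqr_sqrtr; last first.
  by rewrite !mulr_ge0// ?exprn_ge0// ltW.
have Qm : (1 - del) * Q <= Q - 1.
  move: qd; rewrite -/Q -[Q^-1]mul1r ler_pdivrMr// => h; lra.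
have vi : 1 - 4 * del <= (1 + 4 * del)^-1.
  rewrite -[leRHS]mul1r ler_pdivlMr//.
  have : 0 <= del * del by rewrite mulr_ge0 ?ltW.
  lra.
have tQ : 0 < t * Q by rewrite mulr_gt0.
(* Three losses: 1 - del for ln k against ln ln q^(k+1), 1 - 4 del for 1/(1 + 4 del), and 1 - del
   for q - 1 against q. Their product dominates (1 - 6 del)^2 because del <= 1/9. *)
apply: (@le_trans _ _ (2 * ((1 - del) * Lb) * (1 - 4 * del) * (t * ((1 - del) * Q)))).
  rewrite [Q ^+ k.+1]exprSr -/t.
  rewrite [leLHS](_ : _ = (1 - 6 * del) ^+ 2 * (2 * (t * Q) * Lb)); last by ring.
  rewrite [leRHS](_ : _ = ((1 - del) ^+ 2 * (1 - 4 * del)) * (2 * (t * Q) * Lb)); last by ring.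
  rewrite ler_pM2r ?mulr_gt0//.
  have d2 : del * del <= del * 9^-1 by rewrite ler_pM2l.
  have d3 : del * (del * del) <= del * del * 9^-1 by rewrite mulrCA mulrC ler_wpM2l// mulr_ge0 ?ltW.
  rewrite !expr2; lra.
apply: ler_pM.
- by rewrite !mulr_ge0 ?ltW//; lra.
- by rewrite !mulr_ge0 ?ltW//; lra.
- rewrite /x; apply: ler_pM => //; first by rewrite !mulr_ge0 ?ltW//; lra.
    by lra.
  by rewrite ler_pM2l.
- by rewrite /L ler_pM2l.
Qed.

End RealEstimates.

(** * Bounded measurable functions and their integrals under one measure *)

Section BoundedMeasurable.
Context {R : realType} {d : measure_display} {T : measurableType d}.
Implicit Types f g : T -> R.

Lemma inH_cst (c : R) : inH (fun _ : T => c).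
Proof. by split => //; exists `|c|. Qed.

Lemma inHD f g : inH f -> inH g -> inH (fun w => f w + g w).
Proof.
move=> [mf [a fa]] [mg [b gb]]; split; first exact: measurable_funD.
by exists (a + b) => w; rewrite (le_trans (ler_normD _ _))// lerD.
Qed.

Lemma inHM f g : inH f -> inH g -> inH (fun w => f w * g w).
Proof.
move=> [mf [a fa]] [mg [b gb]]; split; first exact: measurable_funM.
by exists (a * b) => w; rewrite normrM ler_pM.
Qed.

Lemma inHN f : inH f -> inH (fun w => - f w).
Proof.
move=> [mf [a fa]]; split; first exact: measurable_funN.
by exists a => w; rewrite normrN.
Qed.

Lemma inHB f g : inH f -> inH g -> inH (fun w => f w - g w).
Proof. by move=> hf hg; apply: inHD => //; exact: inHN. Qed.

Lemma inHX f n : inH f -> inH (fun w => f w ^+ n).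
Proof.
move=> [mf [a fa]]; split; first exact: measurable_funX.
by exists (a ^+ n) => w; rewrite normrX lerXn2r// nnegrE// (le_trans _ (fa w)).
Qed.

Lemma inH_sum (I : Type) (r : seq I) (F : I -> T -> R) :
  (forall i, inH (F i)) -> inH (fun w => \sum_(i <- r) F i w).
Proof.
move=> hF; elim: r => [|i r IH].
  by under eq_fun do rewrite big_nil; exact: inH_cst.
by under eq_fun do rewrite big_cons; exact: inHD.
Qed.

Lemma inH_expR f : inH f -> inH (fun w => expR (f w)).
Proof.
move=> [mf [a fa]]; split; first exact: measurableT_comp.
exists (expR a) => w; rewrite ger0_norm ?expR_ge0// ler_expR.
by rewrite (le_trans (ler_norm _)).
Qed.

Lemma inH_bool (b : T -> bool) : measurable_fun setT b -> inH (fun w => (b w)%:R : R).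
Proof.
move=> mb; split; last by exists 1 => w; case: (b w); rewrite ?normr1 ?normr0.
rewrite (_ : (fun w => _) = (fun c : bool => c%:R) \o b)//.
exact: measurableT_comp.
Qed.

Lemma inH_ltr f g : inH f -> inH g -> inH (fun w => (f w < g w)%R%:R : R).
Proof. by move=> [mf _] [mg _]; apply: inH_bool; exact: measurable_fun_ltr. Qed.

Lemma inH_indic (A : set T) : measurable A -> inH (\1_A : T -> R).
Proof.
move=> mA; split; first exact/measurable_indicP.
by exists 1 => w; rewrite indicE; case: (_ \in _); rewrite ?normr1 ?normr0.
Qed.

Lemma inH_integrable (P : probability T R) f : inH f -> P.-integrable setT (EFin \o f).
Proof.
move=> [mf [a fa]]; apply: measurable_bounded_integrable => //.
- by have h := @probability_setT _ _ _ P; apply: (@le_lt_trans _ _ 1%E); [rewrite -h|rewrite ltry].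
exists a; split; first exact: num_real.
by move=> x ax w _ /=; rewrite (le_trans (fa w))// ltW.
Qed.

Variable P : probability T R.
Local Notation E f := (\int[P]_w f w).

Lemma ExpD f g : inH f -> inH g -> \int[P]_w (f w + g w) = E f + E g.
Proof. by move=> hf hg; rewrite RintegralD//; exact: inH_integrable. Qed.

Lemma ExpB f g : inH f -> inH g -> \int[P]_w (f w - g w) = E f - E g.
Proof. by move=> hf hg; rewrite RintegralB//; exact: inH_integrable. Qed.

Lemma ExpZ c f : inH f -> \int[P]_w (c * f w) = c * E f.
Proof. by move=> hf; rewrite RintegralZl//; exact: inH_integrable. Qed.

Lemma ExpN f : inH f -> \int[P]_w (- f w) = - E f.
Proof.
by move=> hf; rewrite -mulN1r -ExpZ//; apply: eq_Rintegral => w _; rewrite mulN1r.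
Qed.

Lemma Exp_cst c : \int[P]_w c = c.
Proof.
rewrite Rintegral_cst// -[RHS]mulr1; congr (_ * _).
by rewrite -[RHS]/(fine 1%E); congr fine; exact: probability_setT.
Qed.

Lemma le_Exp f g : inH f -> inH g -> (forall w, f w <= g w) -> E f <= E g.
Proof. by move=> hf hg fg; rewrite le_Rintegral//; exact: inH_integrable. Qed.

Lemma Exp_EFin f : inH f -> (\int[P]_w (f w)%:E)%E = (E f)%:E.
Proof.
move=> hf; rewrite fineK//; apply: integrable_fin_num => //.
exact: inH_integrable.
Qed.

Lemma Exp_norm_le f a : inH f -> (forall w, `|f w| <= a) -> `|E f| <= a.
Proof.
move=> hf fa; rewrite ler_norml -{1}(Exp_cst (- a)) -{2}(Exp_cst a).
by apply/andP; split; apply: le_Exp => //; try exact: inH_cst;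
  move=> w; have := fa w; rewrite ler_norml => /andP[].
Qed.

Lemma Exp_bool (b : T -> bool) : measurable_fun setT b ->
  (\int[P]_w (b w)%:R)%:E = P [set w | b w].
Proof.
move=> mb; have hb := inH_bool mb; rewrite -Exp_EFin//.
have mB : measurable [set w | b w].
  by rewrite -[X in measurable X]setTI; exact: mb.
transitivity (\int[P]_w (\1_[set w | b w] w)%:E)%E.
  apply: eq_integral => w _; rewrite indicE; congr (_%:R%:E).
  by have [bw|bw] := boolP (b w); [rewrite mem_set|rewrite memNset//; exact/negP].
by rewrite integral_indic// setIT.
Qed.

Lemma Exp_indic (A : set T) : measurable A -> P A = (\int[P]_w \1_A w)%:E.
Proof.
by move=> mA; rewrite -Exp_EFin ?integral_indic ?setIT//; exact: inH_indic.
Qed.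

End BoundedMeasurable.

(** * The upper expectation as a real-valued functional *)

Section UpperExpectation.
Context {R : realType} {d : measure_display} {T : measurableType d}.
Variable Ps : set (probability T R).
Hypothesis Ps0 : Ps !=set0.
Implicit Types f g : T -> R.

Definition uE f : R := fine (upE Ps f).

Lemma upE_fineK f : inH f -> upE Ps f = (uE f)%:E.
Proof.
move=> hf; rewrite /uE fineK//; have [P PsP] := Ps0.
have [mf [a fa]] := hf.
rewrite fin_numElt; apply/andP; split.
  apply: (@lt_le_trans _ _ (\int[P]_w (f w)%:E)%E); last first.
    by apply: ereal_sup_ubound; exists P.
  by rewrite Exp_EFin// ltNyr.
apply: (@le_lt_trans _ _ a%:E); last by rewrite ltry.
apply: ge_ereal_sup => _ [Q PsQ <-]; rewrite Exp_EFin// lee_fin.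
by rewrite (le_trans (ler_norm _))// Exp_norm_le.
Qed.

Lemma Exp_le_uE P f : Ps P -> inH f -> \int[P]_w f w <= uE f.
Proof.
move=> PsP hf; rewrite -lee_fin -upE_fineK// -Exp_EFin//.
by apply: ereal_sup_ubound; exists P.
Qed.

Lemma uE_le f c : inH f -> (forall P, Ps P -> \int[P]_w f w <= c) -> uE f <= c.
Proof.
move=> hf fc; rewrite -lee_fin -upE_fineK//.
by apply: ge_ereal_sup => _ [P PsP <-]; rewrite Exp_EFin// lee_fin fc.
Qed.

Lemma uE_gt f c : inH f -> c < uE f -> exists2 P, Ps P & c < \int[P]_w f w.
Proof.
move=> hf; rewrite -lte_fin -upE_fineK// => /ereal_sup_gt[_ [P PsP <-]].
by rewrite Exp_EFin// lte_fin; exists P.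
Qed.

Lemma le_uE f g : inH f -> inH g -> (forall w, f w <= g w) -> uE f <= uE g.
Proof.
move=> hf hg fg; apply: uE_le => // P PsP.
by apply: le_trans (Exp_le_uE PsP hg); exact: le_Exp.
Qed.

Lemma uE_affine a b f : 0 <= b -> inH f -> uE (fun w => a + b * f w) = a + b * uE f.
Proof.
move=> b0 hf; have hc := inH_cst.
have hbf : inH (fun w => b * f w) by exact: inHM.
have habf : inH (fun w => a + b * f w) by exact: inHD.
apply/le_anti/andP; split.
  apply: uE_le => // P PsP; rewrite ExpD// Exp_cst ExpZ//.
  by rewrite lerD2l ler_wpM2l// Exp_le_uE.
have [b00|bn0] := eqVneq b 0.
  rewrite b00 mul0r; have [P PsP] := Ps0.
  rewrite -[leLHS](Exp_cst P) addr0.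
  rewrite (_ : (fun w => a + 0 * f w) = (fun=> a)); last first.
    by apply/funext => w; rewrite mul0r addr0.
  by apply: Exp_le_uE.
have {}b0 : 0 < b by rewrite lt_def bn0.
rewrite -lerBrDl mulrC -ler_pdivlMr//; apply: uE_le => // P PsP.
rewrite ler_pdivlMr// lerBrDl mulrC -ExpZ// -[X in X + _](Exp_cst P) -ExpD//.
exact: Exp_le_uE.
Qed.

Lemma uE_cst c : uE (fun=> c) = c.
Proof.
have := @uE_affine c 0 (fun=> 0) (lexx _) (inH_cst _).
by rewrite !mul0r !addr0.
Qed.

Lemma loE_uE f : inH f -> loE Ps f = (- uE (fun w => - f w))%:E.
Proof.
move=> hf; have hNf := inHN hf.
rewrite EFinN -upE_fineK// /loE /upE ereal_infEN; congr (- ereal_sup _)%E.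
have EN (P : probability T R) : ((\int[P]_w (- f w)%:E) = - (\int[P]_w (f w)%:E))%E.
  by rewrite !Exp_EFin// ExpN.
apply/seteqP; split => [_ [_ [P PsP <-] <-]|_ [P PsP <-]]; first by exists P.
by exists (\int[P]_w (f w)%:E)%E => //; exists P.
Qed.

End UpperExpectation.

(** * Bounded functions of the past *)

Section Adapted.
Context {R : realType} {d : measure_display} {T : measurableType d}.
Variable X : nat -> T -> R.
Hypothesis mX : forall n, measurable_fun setT (X n).
Implicit Types F G : T -> R.

(** Measurability with respect to the past is encoded by an explicit function of the tuple, the form
    in which Peng independence is stated. The past at time [m] consists of [X 0], ..., [X (m-1)], so
    [X m] is the next variable. *)
Definition adapted (m : nat) F : Prop :=
  (exists2 A : m.-tuple R -> R, measurable_fun setT A &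
     forall w, F w = A [tuple X j w | j < m]) /\
  exists M : R, forall w, `|F w| <= M.

Lemma measurable_past m : measurable_fun setT (fun w => [tuple X j w | j < m]).
Proof.
apply/measurable_fun_tnthP => i.
rewrite (_ : _ \o _ = X i); first exact: mX.
by apply/funext => w /=; rewrite tnth_mktuple.
Qed.

Lemma adapted_inH m F : adapted m F -> inH F.
Proof.
move=> [[A mA FA] bF]; split => //.
rewrite (_ : F = A \o (fun w => [tuple X j w | j < m])); last exact/funext.
by apply: measurableT_comp => //; exact: measurable_past.
Qed.

Lemma adapted_cst m c : adapted m (fun=> c).
Proof. by split; [exists (fun=> c)|exists `|c|]. Qed.

Lemma adaptedD m F G : adapted m F -> adapted m G -> adapted m (fun w => F w + G w).
Proof.
move=> aF aG; have [_ bFG] := inHD (adapted_inH aF) (adapted_inH aG).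
split => //; move: aF aG => [[A mA FA] _] [[B mB GB] _].
exists (fun x => A x + B x); first exact: measurable_funD.
by move=> w; rewrite FA GB.
Qed.

Lemma adaptedM m F G : adapted m F -> adapted m G -> adapted m (fun w => F w * G w).
Proof.
move=> aF aG; have [_ bFG] := inHM (adapted_inH aF) (adapted_inH aG).
split => //; move: aF aG => [[A mA FA] _] [[B mB GB] _].
exists (fun x => A x * B x); first exact: measurable_funM.
by move=> w; rewrite FA GB.
Qed.

Lemma adaptedN m F : adapted m F -> adapted m (fun w => - F w).
Proof.
move=> aF; under eq_fun do rewrite -mulN1r.
by apply: adaptedM => //; exact: adapted_cst.
Qed.

Lemma adaptedB m F G : adapted m F -> adapted m G -> adapted m (fun w => F w - G w).
Proof. by move=> aF aG; apply: adaptedD => //; exact: adaptedN. Qed.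

Lemma adapted_expR m F : adapted m F -> adapted m (fun w => expR (F w)).
Proof.
move=> aF; have [_ bF] := inH_expR (adapted_inH aF).
split => //; move: aF => [[A mA FA] _].
exists (fun x => expR (A x)); first exact: measurableT_comp.
by move=> w; rewrite FA.
Qed.

Lemma adapted_ltr m F G : adapted m F -> adapted m G ->
  adapted m (fun w => (F w < G w)%R%:R).
Proof.
move=> aF aG; have [_ bFG] := inH_ltr (adapted_inH aF) (adapted_inH aG).
split => //; move: aF aG => [[A mA FA] _] [[B mB GB] _].
exists (fun x => (A x < B x)%R%:R); last by move=> w; rewrite FA GB.
rewrite (_ : (fun x => _) = (fun c : bool => c%:R) \o (fun x => A x < B x))//.
by apply: measurableT_comp => //; exact: measurable_fun_ltr.
Qed.

Lemma adaptedW m n F : (m <= n)%N -> adapted m F -> adapted n F.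
Proof.
move=> mn [[A mA FA] bF]; split => //.
pose r (t : n.-tuple R) := [tuple tnth t (widen_ord mn j) | j < m].
exists (A \o r).
  apply: measurableT_comp => //; apply/measurable_fun_tnthP => i.
  rewrite (_ : _ \o _ = @tnth n R ^~ (widen_ord mn i)).
    exact: measurable_tnth.
  by apply/funext => t /=; rewrite tnth_mktuple.
move=> w; rewrite FA /=; congr A; apply/eq_from_tnth => i.
by rewrite !tnth_mktuple.
Qed.

Lemma adapted_comp (m n : nat) (h : R -> R) : (m < n)%N -> measurable_fun setT h ->
  inH (h \o X m) -> adapted n (h \o X m).
Proof.
move=> mn mh [_ bh]; split => //.
exists (fun t => h (tnth t (Ordinal mn))); last first.
  by move=> w; rewrite /= tnth_mktuple.
by apply: (@measurableT_comp _ _ _ _ _ _ h) => //; exact: measurable_tnth.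
Qed.

Lemma adapted_sum (I : Type) (r : seq I) (Q : pred I) m (F : I -> T -> R) :
  (forall i, Q i -> adapted m (F i)) -> adapted m (fun w => \sum_(i <- r | Q i) F i w).
Proof.
move=> aF; elim: r => [|i r IH].
  by under eq_fun do rewrite big_nil; exact: adapted_cst.
case Qi: (Q i); under eq_fun do rewrite big_cons Qi; last exact: IH.
by apply: adaptedD => //; exact: aF.
Qed.

Lemma adapted_prod (I : Type) (r : seq I) (Q : pred I) m (F : I -> T -> R) :
  (forall i, Q i -> adapted m (F i)) -> adapted m (fun w => \prod_(i <- r | Q i) F i w).
Proof.
move=> aF; elim: r => [|i r IH].
  by under eq_fun do rewrite big_nil; exact: adapted_cst.
case Qi: (Q i); under eq_fun do rewrite big_cons Qi; last exact: IH.
by apply: adaptedM => //; exact: aF.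
Qed.

End Adapted.

(** * One-step consequences of Peng independence *)

Section PengIndependence.
Context {R : realType} {d : measure_display} {T : measurableType d}.
Variables (Ps : set (probability T R)) (X : nat -> T -> R).
Hypothesis Ps0 : Ps !=set0.
Hypothesis mX : forall n, measurable_fun setT (X n).
Hypothesis iidX : iid Ps X.
Implicit Types F G : T -> R.
Local Notation uE := (uE Ps).

Lemma uE_ident h n : measurable_fun setT h -> (forall n, inH (h \o X n)) ->
  uE (h \o X n) = uE (h \o X 0).
Proof. by move=> mh hh; congr fine; case: iidX => + _; exact. Qed.

(** Independence is applied to a test function affine in h(y); its inner expectation is computed by
    positive homogeneity, hence the sign condition on [G]. *)
Lemma uE_indep m F G h : adapted X m F -> adapted X m G -> (forall w, 0 <= G w) ->
  measurable_fun setT h -> (forall n, inH (h \o X n)) ->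
  uE (fun w => F w + G w * h (X m w)) = uE (fun w => F w + uE (h \o X 0) * G w).
Proof.
move=> aF aG G0 mh hh; set nu := uE (h \o X 0).
have iF := adapted_inH mX aF; have iG := adapted_inH mX aG.
move: aF aG => [[A mA FA] _] [[B mB GB] _].
(* [B] is known to be nonnegative only at tuples taken by the past, whereas the inner expectation is
   formed at every tuple. *)
pose C x := Num.max (B x) 0.
have C0 x : 0 <= C x by rewrite le_max lexx orbT.
have GC w : G w = C [tuple X j w | j < m] by rewrite /C -GB; apply/esym/max_idPl.
have affine (a c : R) : 0 <= c -> uE (fun w => a + c * h (X m w)) = a + nu * c.
  move=> c0; rewrite uE_affine//; last exact: hh.
  by rewrite (uE_ident _ mh hh) mulrC.
(* [iid] provides independence only for positive indices; with an empty past [F] and [G] are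
   constants and the claim is affine. *)
have [m0|m0] := posnP m.
  subst m.
  have Fa w : F w = A [tuple] by rewrite FA; congr A; exact: tuple0.
  have Gc w : G w = C [tuple] by rewrite GC; congr C; exact: tuple0.
  under eq_fun do rewrite Fa Gc.
  under [in RHS]eq_fun do rewrite Fa Gc.
  by rewrite affine// uE_cst.
pose phi (p : m.-tuple R * R) := A p.1 + C p.1 * h p.2.
have mC : measurable_fun setT C by exact: measurable_maxr.
have mphi : measurable_fun setT phi.
  apply: measurable_funD; first exact: (measurableT_comp mA).
  apply: measurable_funM; first exact: (measurableT_comp mC).
  exact: (measurableT_comp mh).
have := iidX.2 m m0 phi mphi.
have E1 : (fun w => phi ([tuple X j w | j < m], X m w)) = (fun w => F w + G w * h (X m w)).
  by apply/funext => w; rewrite /phi /= -FA -GC.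
have E2 : (fun x => fine (upE Ps (fun w => phi (x, X m w)))) \o
   (fun w => [tuple X j w | j < m]) = (fun w => F w + nu * G w).
  apply/funext => w /=; rewrite -/(uE _) /phi /= affine//.
  by rewrite -FA -GC.
rewrite E1 => H; congr fine; rewrite -E2; apply: H.
- by apply: inHD => //; apply: inHM => //; exact: hh.
- move=> x; rewrite /phi /=.
  apply: inHD; first exact: inH_cst.
  by apply: inHM; [exact: inH_cst|exact: hh].
- have : inH (fun w => F w + nu * G w).
    by apply: inHD => //; apply: inHM => //; exact: inH_cst.
  by rewrite -E2.
Qed.

Lemma uE_indepN m F G h : adapted X m F -> adapted X m G -> (forall w, 0 <= G w) ->
  measurable_fun setT h -> (forall n, inH (h \o X n)) ->
  uE (fun w => F w - G w * h (X m w)) =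
  uE (fun w => F w - - uE (fun w => - h (X 0 w)) * G w).
Proof.
move=> aF aG G0 mh hh.
have H := @uE_indep m F G (fun x => - h x) aF aG G0 (measurable_funN mh)
  (fun n => inHN (hh n)).
transitivity (uE (fun w => F w + G w * - h (X m w))).
  by congr uE; apply/funext => w; rewrite mulrN.
by rewrite H; congr uE; apply/funext => w; rewrite mulNr opprK.
Qed.

(** With [F] = -nu [G] the right-hand side of [uE_indep] is the upper expectation of 0, and each P
    lies below the upper expectation. This is the tested form of: the conditional mean of h(X m)
    given the past is at most nu. *)
Lemma cond_Exp_le P m G h : Ps P -> adapted X m G -> (forall w, 0 <= G w) ->
  measurable_fun setT h -> (forall n, inH (h \o X n)) ->
  \int[P]_w (G w * h (X m w)) <= uE (h \o X 0) * \int[P]_w G w.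
Proof.
move=> PsP aG G0 mh hh; set nu := uE _.
have iG := adapted_inH mX aG.
have inG : inH (fun w => nu * G w) by apply: inHM => //; exact: inH_cst.
have iGh : inH (fun w => G w * h (X m w)) by apply: inHM => //; exact: hh.
have anG : adapted X m (fun w => - (nu * G w)).
  by apply: adaptedN => //; apply: adaptedM => //; exact: adapted_cst.
have := uE_indep anG aG G0 mh hh; rewrite -/nu.
under [in RHS]eq_fun do rewrite addNr; rewrite uE_cst// => e.
have : \int[P]_w (- (nu * G w) + G w * h (X m w)) <= 0.
  by rewrite -e; apply: Exp_le_uE => //; apply: inHD => //; exact: inHN.
rewrite ExpD//; last exact: inHN.
by rewrite ExpN// ExpZ//; lra.
Qed.

Lemma cond_Exp_ge P m G h : Ps P -> adapted X m G -> (forall w, 0 <= G w) ->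
  measurable_fun setT h -> (forall n, inH (h \o X n)) ->
  - uE (fun w => - h (X 0 w)) * \int[P]_w G w <= \int[P]_w (G w * h (X m w)).
Proof.
move=> PsP aG G0 mh hh; have iG := adapted_inH mX aG.
have iGh : inH (fun w => G w * h (X m w)) by apply: inHM => //; exact: hh.
have := @cond_Exp_le P m G (fun x => - h x) PsP aG G0 (measurable_funN mh)
  (fun n => inHN (hh n)).
rewrite (_ : \int[P]_w (G w * - h (X m w)) = - \int[P]_w (G w * h (X m w))).
  by rewrite -/(comp (fun x => - h x) (X 0)) mulNr lerNl.
by rewrite -ExpN//; apply: eq_Rintegral => w _; rewrite mulrN.
Qed.

(** Identical distribution transfers the bound: the indicator of |x| > M has upper expectation 0 at
    [X 0], hence at every [X n]. A bound common to all n controls the jumps of the normalized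
    sums. *)
Lemma ae_norm_le P M : Ps P -> (forall w, `|X 0 w| <= M) ->
  \forall w \ae P, forall n, `|X n w| <= M.
Proof.
move=> PsP XM; apply: ae_foralln => n.
pose b (x : R) := M < `|x|.
have mb : measurable_fun setT b.
  by apply: measurable_fun_ltr; [exact: measurable_cst|exact: normr_measurable].
have mbX k : measurable_fun setT (b \o X k) by exact: measurableT_comp.
pose h (x : R) : R := (b x)%:R.
have hh k : inH (h \o X k) by exact: (inH_bool (mbX k)).
have mh : measurable_fun setT h.
  by rewrite (_ : h = (fun c : bool => c%:R) \o b)//; exact: measurableT_comp.
have u0 : uE (h \o X 0) = 0.
  rewrite -[RHS](uE_cst Ps0); congr uE; apply/funext => w.
  by rewrite /h /b /= ltNge XM.
have le0 : \int[P]_w (b (X n w))%:R <= 0.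
  by rewrite -u0 -(uE_ident n mh hh); exact: (Exp_le_uE Ps0 PsP (hh n)).
exists [set w | b (X n w)]; split.
- by rewrite -[X in measurable X]setTI; exact: mbX.
- have := Exp_bool P (mbX n) => /= e.
  by apply/eqP; rewrite eq_le measure_ge0 andbT; move: le0; rewrite -lee_fin e.
- by move=> w /= /negP; rewrite -ltNge.
Qed.

End PengIndependence.

(** * Chernoff products over disjoint blocks *)

Section Degeneracy.
Context {R : realType} {d : measure_display} {T : measurableType d}.
Variables (Ps : set (probability T R)) (X : nat -> T -> R).
Hypothesis Ps0 : Ps !=set0.
Hypothesis mX : forall n, measurable_fun setT (X n).
Hypothesis iidX : iid Ps X.
Implicit Types F G : T -> R.
Local Notation uE := (uE Ps).

Lemma adapted_prod_nat m n (h : R -> R) : measurable_fun setT h ->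
  (forall n, inH (h \o X n)) -> adapted X n (fun w => \prod_(m <= i < n) h (X i w)).
Proof.
move=> mh hh; under eq_fun do rewrite big_nat_cond.
apply: adapted_prod => // i /andP[/andP[_ i_n] _].
exact: (adapted_comp i_n mh (hh i)).
Qed.

(** The last factor of the product is independent of all that precedes it and may be replaced by its
    lower mean [rho]. The induction generalizes [G], which absorbs [rho] and stays nonnegative. *)
Lemma uE_subr_prod m L F G h : adapted X m F -> adapted X m G -> (forall w, 0 <= G w) ->
  measurable_fun setT h -> (forall n, inH (h \o X n)) -> (forall x, 0 <= h x) ->
  uE (fun w => F w - G w * \prod_(m <= i < m + L) h (X i w)) =
  uE (fun w => F w - (- uE (fun w => - h (X 0 w))) ^+ L * G w).
Proof.
move=> aF aG G0 mh hh h0; set rho := - uE _.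
have rho0 : 0 <= rho.
  rewrite oppr_ge0 -[leRHS](uE_cst Ps0); apply: le_uE => //.
  - exact: (inHN (hh 0%N)).
  - exact: inH_cst.
  - by move=> w; rewrite oppr_le0.
elim: L G aG G0 => [|L IH] G aG G0.
  by congr uE; apply/funext => w; rewrite addn0 big_geq// mulr1 mul1r.
have aGL : adapted X (m + L) (fun w => G w * \prod_(m <= i < m + L) h (X i w)).
  apply: adaptedM => //; last exact: adapted_prod_nat.
  exact: adaptedW (leq_addr _ _) aG.
transitivity (uE (fun w => F w - (G w * \prod_(m <= i < m + L) h (X i w)) * h (X (m + L)%N w))).
  congr uE; apply/funext => w; rewrite addnS big_nat_recr ?leq_addr//=.
  by rewrite mulrA.
rewrite (uE_indepN Ps0 mX iidX (adaptedW (leq_addr L m) aF) aGL _ mh hh); last first.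
  by move=> w; rewrite mulr_ge0// prodr_ge0.
rewrite -/rho.
transitivity (uE (fun w => F w - (rho * G w) * \prod_(m <= i < m + L) h (X i w))).
  by congr uE; apply/funext => w; rewrite mulrA.
rewrite (IH (fun w => rho * G w)).
- by congr uE; apply/funext => w; rewrite exprSr mulrA.
- by apply: adaptedM => //; exact: adapted_cst.
- by move=> w; rewrite mulr_ge0.
Qed.

(** The block of index k has 2^k factors and comes after all earlier blocks, so the products can be
    peeled off from the latest one, each leaving a power of a lower mean. *)
Lemma uE_dyadic_blocks (h g : R -> R) K n :
  measurable_fun setT h -> (forall n, inH (h \o X n)) -> (forall x, 0 <= h x) ->
  measurable_fun setT g -> (forall n, inH (g \o X n)) -> (forall x, 0 <= g x) ->
  uE (fun w => 1 - \sum_(K <= k < n) \prod_(2 ^ k <= i < 2 ^ k.+1) h (X i w)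
                 - \prod_(2 ^ n <= i < 2 ^ n.+1) g (X i w)) =
  1 - \sum_(K <= k < n) (- uE (fun w => - h (X 0 w))) ^+ (2 ^ k)
    - (- uE (fun w => - g (X 0 w))) ^+ (2 ^ n).
Proof.
move=> mh hh h0 mg hg g0.
have blk k : (2 ^ k.+1 = 2 ^ k + 2 ^ k)%N by rewrite expnS mul2n addnn.
have aS m : adapted X (2 ^ m)
    (fun w => 1 - \sum_(K <= k < m) \prod_(2 ^ k <= i < 2 ^ k.+1) h (X i w)).
  apply: adaptedB => //; first exact: adapted_cst.
  under eq_fun do rewrite big_nat_cond.
  apply: adapted_sum => // k /andP[/andP[_ km] _].
  apply: adaptedW (adapted_prod_nat _ _ mh hh) => //.
  by rewrite leq_exp2l.
have peel F m f : adapted X (2 ^ m) F -> measurable_fun setT f ->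
    (forall n, inH (f \o X n)) -> (forall x, 0 <= f x) ->
    uE (fun w => F w - \prod_(2 ^ m <= i < 2 ^ m.+1) f (X i w)) =
    uE F - (- uE (fun w => - f (X 0 w))) ^+ (2 ^ m).
  move=> aF mf hf f0; set rho := - uE _.
  transitivity (uE (fun w => F w - 1 * \prod_(2 ^ m <= i < 2 ^ m + 2 ^ m) f (X i w))).
    by congr uE; apply/funext => w; rewrite mul1r blk.
  rewrite (@uE_subr_prod _ _ F (fun=> 1) f)//; last exact: adapted_cst.
  rewrite -/rho.
  transitivity (uE (fun w => - rho ^+ (2 ^ m) + 1 * F w)).
    by congr uE; apply/funext => w; rewrite /= mulr1 mul1r addrC.
  by rewrite uE_affine//; [rewrite mul1r addrC|exact: (adapted_inH mX aF)].
rewrite peel//; congr (_ - _); elim: n => [|n IH].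
  rewrite big_geq// subr0 -[RHS](uE_cst Ps0); congr uE; apply/funext => w.
  by rewrite big_geq// subr0.
have [Kn|nK] := leqP K n; last first.
  rewrite big_geq// subr0 -[RHS](uE_cst Ps0); congr uE; apply/funext => w.
  by rewrite big_geq// subr0.
rewrite big_nat_recr//= opprD addrA -IH -peel//.
by congr uE; apply/funext => w; rewrite big_nat_recr//= opprD addrA.
Qed.

(** A negative mean makes the exponential moment decrease at first order in l. One measure suffices,
    since the lower expectation is an infimum. *)
Lemma exp_moment_lt1 P (g : T -> R) : Ps P -> inH g -> \int[P]_w g w < 0 ->
  exists2 l, 0 < l & - uE (fun w => - expR (l * g w)) < 1.
Proof.
move=> PsP hg Eg; have [_ [a ga]] := hg.
pose A := `|a| + 1; have A0 : 0 < A by rewrite ltr_wpDl.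
have gA w : `|g w| <= A.
  by rewrite (le_trans (ga w))// (le_trans (ler_norm a))// lerDl.
pose e := - \int[P]_w g w; have e0 : 0 < e by rewrite oppr_gt0.
(* The first bound gives |l g| <= 1/2, as the quadratic estimate requires; the second keeps the
   quadratic term below half of the linear gain l e. *)
pose l := Num.min (2 * A)^-1 (e / (4 * A ^+ 2)).
have l0 : 0 < l by rewrite lt_min invr_gt0 mulr_gt0//= divr_gt0// mulr_gt0// exprn_gt0.
have lA : l * A <= 2^-1.
  by rewrite -ler_pdivlMr// -invfM ge_min lexx.
have lA2 : 2 * (l * A ^+ 2) <= e / 2.
  have : l <= e / (4 * A ^+ 2) by rewrite ge_min lexx orbT.
  rewrite ler_pdivlMr ?mulr_gt0// ?exprn_gt0//; lra.
exists l => //.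
have hlg : inH (fun w => l * g w) by apply: inHM => //; exact: inH_cst.
have hE := inH_expR hlg.
have : \int[P]_w expR (l * g w) <= 1 + l * \int[P]_w g w + 2 * (l * A) ^+ 2.
  rewrite -ExpZ// -[X in X + _ + _](Exp_cst P) -[X in _ + _ + X](Exp_cst P).
  have c1 := @inH_cst R d T 1; have c2 := @inH_cst R d T (2 * (l * A) ^+ 2).
  have s1 : inH (fun w => 1 + l * g w) by exact: inHD.
  rewrite -ExpD// -ExpD//; apply: le_Exp => //; first exact: inHD.
  move=> w; have lg : `|l * g w| <= l * A.
    by rewrite normrM gtr0_norm// ler_pM2l.
  apply: le_trans (expR_le_quadratic (le_trans lg lA)) _.
  rewrite lerD2l ler_pM2l// -(real_normK (num_real (l * g w))).
  by rewrite lerXn2r// nnegrE// ltW// mulr_gt0.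
have : - uE (fun w => - expR (l * g w)) <= \int[P]_w expR (l * g w).
  by rewrite lerNl -ExpN//; apply: Exp_le_uE => //; exact: inHN.
have -> : \int[P]_w g w = - e by rewrite opprK.
move=> h1 h2; apply: le_lt_trans (le_trans h1 h2) _.
have -> : 2 * (l * A) ^+ 2 = l * (2 * (l * A ^+ 2)) by ring.
have : l * (2 * (l * A ^+ 2)) <= l * (e / 2) by rewrite ler_pM2l.
have : 0 < l * e by rewrite mulr_gt0.
lra.
Qed.

End Degeneracy.

(** * Continuity from above excludes ambiguity of the mean *)

Section ContinuityForcesLinearity.
Context {R : realType} {d : measure_display} {T : measurableType d}.
Variables (Ps : set (probability T R)) (X : nat -> T -> R).
Hypothesis Ps0 : Ps !=set0.
Hypothesis mX : forall n, measurable_fun setT (X n).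
Hypothesis iidX : iid Ps X.
Hypothesis cV : continuous_capacity (upV Ps).
Local Notation uE := (uE Ps).

Lemma upV_ge (A : set T) (f : T -> R) (c : R) : measurable A -> inH f ->
  (forall w, f w <= \1_A w) -> c < uE f -> (c%:E <= upV Ps A)%E.
Proof.
move=> mA hf fA /(uE_gt Ps0 hf)[P PsP cf].
apply: (@le_trans _ _ (P A)); last by apply: ereal_sup_ubound; exists P.
by rewrite (Exp_indic P mA) lee_fin (le_trans (ltW cf))// le_Exp//; exact: inH_indic.
Qed.

Lemma le_upV (A B : set T) : measurable A -> measurable B -> A `<=` B ->
  (upV Ps A <= upV Ps B)%E.
Proof.
move=> mA mB AB; apply: ge_ereal_sup => _ [P PsP <-].
apply: (@le_trans _ _ (P B)); last by apply: ereal_sup_ubound; exists P.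
by apply: le_measure; rewrite ?inE.
Qed.

(** The unions of the tails of a disjoint sequence decrease to the empty set, so continuity sends
    their upper probability to 0, yet the m-th one contains [D m]. *)
Lemma no_disjoint_heavy_sets (D : nat -> set T) (c : R) : 0 < c ->
  (forall n, measurable (D n)) -> trivIset setT D ->
  ~ (forall n, (c%:E <= upV Ps (D n))%E).
Proof.
move=> c0 mD tD hD.
pose A m := \bigcup_(n in [set n | (m <= n)%N]) D n.
have mA m : measurable (A m) by exact: bigcup_measurable.
have := cV.2 A mA.
have -> : \bigcap_m A m = set0.
  apply/seteqP; split => // w wA.
  have [n _ Dn] := wA 0%N I.
  have [k /= nk Dk] := wA n.+1 I.
  have : n = k by apply: tD => //; exists w.
  by move=> e; rewrite e ltnn in nk.
have -> : upV Ps set0 = 0%E.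
  have [P PsP] := Ps0.
  rewrite /upV (_ : [set _ | _ in _] = [set 0%E]) ?ereal_sup1//.
  by apply/seteqP; split=> [_ [Q _ <-]|_ ->]; [|exists P => //]; rewrite measure0.
move=> H; have {}H := H _.
have cvA : (fun n => upV Ps (A n)) @ \oo --> 0%E.
  apply: H => m n mn w [k /= nk Dk]; exists k => //=.
  exact: leq_trans nk.
have : (c%:E <= limn (fun n => upV Ps (A n)))%E.
  apply: lime_ge; first by apply/cvg_ex; exists 0%E.
  apply: nearW => n; apply: le_trans (hD n) _; apply: le_upV => //.
  by move=> w Dw; exists n => /=.
by rewrite (cvg_lim _ cvA)// lee_fin leNgt c0.
Qed.

(* If the lower mean of [f (X 0)] were below [c] and its upper mean above [c],
   then for each [n] some measure makes the dyadic block averages smaller than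
   [c] up to block [n] and at least [c] on block [n]; these events are
   disjoint and all have upper probability at least 1/4. *)
Lemma uE_linear (f : R -> R) : measurable_fun setT f ->
  (forall n, inH (f \o X n)) -> - uE (fun w => - f (X 0 w)) = uE (f \o X 0).
Proof.
move=> mf hf; have [P0 PsP0] := Ps0.
apply/le_anti/andP; split.
  apply: (@le_trans _ _ (\int[P0]_w f (X 0 w))); last exact: (Exp_le_uE Ps0 PsP0 (hf 0%N)).
  rewrite lerNl -ExpN//; last exact: (hf 0%N).
  by apply: Exp_le_uE => //; exact: (inHN (hf 0%N)).
rewrite leNgt; apply/negP => lt.
pose c := (- uE (fun w => - f (X 0 w)) + uE (f \o X 0)) / 2.
have [c1 c2] : - c < uE (fun w => - f (X 0 w)) /\ c < uE (f \o X 0).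
  by move: lt; rewrite /c; split; lra.
have hc := @inH_cst R d T.
have hfc n : inH (fun w => f (X n w) - c) by apply: inHB => //; exact: (hf n).
have hcf n : inH (fun w => c - f (X n w)) by apply: inHB => //; exact: (hf n).
have [P1 PsP1 P1c] := uE_gt Ps0 (inHN (hf 0%N)) c1.
have [P2 PsP2 P2c] := uE_gt Ps0 (hf 0%N) c2.
have [|l1 l10 r1lt] := exp_moment_lt1 Ps0 PsP1 (hfc 0%N).
  rewrite ExpB//; last exact: (hf 0%N).
  by rewrite Exp_cst; move: P1c; rewrite ExpN; [lra|exact: (hf 0%N)].
have [|l2 l20 r2lt] := exp_moment_lt1 Ps0 PsP2 (hcf 0%N).
  rewrite ExpB//; last exact: (hf 0%N).
  by rewrite Exp_cst; move: P2c => /=; lra.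
pose h x := expR (l1 * (f x - c)); pose g x := expR (l2 * (c - f x)).
have mh : measurable_fun setT h.
  apply: measurableT_comp => //; apply: measurable_funM => //.
  exact: measurable_funB.
have mg : measurable_fun setT g.
  apply: measurableT_comp => //; apply: measurable_funM => //.
  exact: measurable_funB.
have hh n : inH (h \o X n) by apply: inH_expR; apply: inHM => //; exact: hfc.
have hg n : inH (g \o X n) by apply: inH_expR; apply: inHM => //; exact: hcf.
have h0 x : 0 <= h x by exact: expR_ge0.
have g0 x : 0 <= g x by exact: expR_ge0.
have [r1 r1E] : exists r, r = - uE (fun w => - h (X 0 w)) := ex_intro _ _ erefl.
have [r2 r2E] : exists r, r = - uE (fun w => - g (X 0 w)) := ex_intro _ _ erefl.
have {}r1lt : r1 < 1 by rewrite r1E; exact: r1lt.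
have {}r2lt : r2 < 1 by rewrite r2E; exact: r2lt.
have r10 : 0 <= r1.
  rewrite r1E oppr_ge0 -[leRHS](uE_cst Ps0); apply: le_uE => //.
    exact: (inHN (hh 0%N)).
  by move=> w; rewrite oppr_le0 h0.
have r20 : 0 <= r2.
  rewrite r2E oppr_ge0 -[leRHS](uE_cst Ps0); apply: le_uE => //.
    exact: (inHN (hg 0%N)).
  by move=> w; rewrite oppr_le0 g0.
have r1b : 0 <= r1 < 1 by rewrite r10 r1lt.
have r2b : 0 <= r2 < 1 by rewrite r20 r2lt.
(* From index [K] on, the geometric tail of [r1] and the single power of [r2] are each below 1/4,
   which leaves more than 1/4 for every event [D n]. *)
have [K1 K1P] : exists K, r1 ^+ K < (1 - r1) / 4.
  by apply: exists_expr_lt => //; rewrite divr_gt0// subr_gt0.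
have [K2 K2P] : exists K, r2 ^+ K < 4^-1 by apply: exists_expr_lt.
pose K := maxn K1 K2.
pose B k w := \sum_(2 ^ k <= i < 2 ^ k.+1) (f (X i w) - c).
have mB k : measurable_fun setT (B k) by case: (inH_sum (index_iota (2 ^ k) (2 ^ k.+1)) hfc).
have mlow k : measurable [set w | B k w < 0].
  have mb : measurable_fun setT (fun w => B k w < 0) by exact: measurable_fun_ltr.
  by rewrite -[X in measurable X]setTI; exact: mb.
pose D n := ~` [set w | B (n + K)%N w < 0] `&`
  \bigcap_(k in [set k | (K <= k < n + K)%N]) [set w | B k w < 0].
have mD n : measurable (D n).
  by apply: measurableI; [exact: measurableC|exact: bigcap_measurableType].
have hprod k w : \prod_(2 ^ k <= i < 2 ^ k.+1) h (X i w) = expR (l1 * B k w).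
  by rewrite /B mulr_sumr expR_sum.
have gprod k w : \prod_(2 ^ k <= i < 2 ^ k.+1) g (X i w) = expR (- (l2 * B k w)).
  rewrite /B mulr_sumr -sumrN expR_sum; apply: eq_bigr => i _.
  by rewrite /g -mulrN opprB.
(* For i < j, [D j] requires a negative sum on block i + K while [D i] denies it. *)
apply: (@no_disjoint_heavy_sets D 4^-1) => //.
  apply/trivIsetP => i j _ _; wlog : i j / (i < j)%N.
    move=> H; rewrite neq_ltn => /orP[ij|ji].
      by apply: H => //; rewrite neq_ltn ij.
    by rewrite setIC; apply: H => //; rewrite neq_ltn ji.
  move=> ij _; apply/seteqP; split => // w [[Di _] [_ Dj]].
  by apply: Di; apply: (Dj (i + K)%N) => /=; rewrite leq_addl ltn_add2r.
(* Chernoff minorant of the indicator of [D n]: off [D n] either an earlier block has a nonnegative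
   sum or block n + K has a negative one, and the corresponding exponential product is at least
   1. *)
move=> n; pose F w := 1 - \sum_(K <= k < n + K) \prod_(2 ^ k <= i < 2 ^ k.+1) h (X i w)
                 - \prod_(2 ^ (n + K) <= i < 2 ^ (n + K).+1) g (X i w).
have uEF : uE F = 1 - \sum_(K <= k < n + K) r1 ^+ (2 ^ k) - r2 ^+ (2 ^ (n + K)).
  by rewrite r1E r2E; exact: (uE_dyadic_blocks Ps0 mX iidX K (n + K) mh hh h0 mg hg g0).
apply: (@upV_ge _ F) => //.
- apply: inHB; first apply: inHB => //.
  + apply: inH_sum => k; apply: (@adapted_inH _ _ _ X mX (2 ^ k.+1)).
    exact: adapted_prod_nat.
  + apply: (@adapted_inH _ _ _ X mX (2 ^ (n + K).+1)); exact: adapted_prod_nat.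
- move=> w; rewrite /F indicE.
  have s0 (Q : pred nat) : 0 <= \sum_(K <= k < n + K | Q k) \prod_(2 ^ k <= i < 2 ^ k.+1) h (X i w).
    by apply: sumr_ge0 => k _; apply: prodr_ge0.
  have p0 : 0 <= \prod_(2 ^ (n + K) <= i < 2 ^ (n + K).+1) g (X i w) by apply: prodr_ge0.
  have := s0 predT; have [wD|wD] := boolP (w \in D n); first by move=> S0; rewrite -addrA -opprD gerBl addr_ge0.
  move=> S0; have : ~ D n w by move: wD; rewrite notin_setE.
  move=> /not_andP[low|].
    have : 1 <= \prod_(2 ^ (n + K) <= i < 2 ^ (n + K).+1) g (X i w).
      rewrite gprod -expR0 ler_expR oppr_ge0; apply/ltW.
      by rewrite pmulr_rlt0//; apply: contrapT.
    by move=> p1; rewrite subr_le0 (le_trans _ p1)// gerBl.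
  move=> /existsNP[k /not_implyP[/= Kk /negP]]; rewrite -leNgt => Bk.
  have : 1 <= \sum_(K <= k < n + K) \prod_(2 ^ k <= i < 2 ^ k.+1) h (X i w).
    rewrite (bigD1_seq k)//= ?mem_index_iota ?iota_uniq//.
    have : 1 <= \prod_(2 ^ k <= i < 2 ^ k.+1) h (X i w).
      by rewrite hprod -expR0 ler_expR mulr_ge0// ltW.
    by move=> /le_trans; apply; rewrite lerDl s0.
  by move=> S1; rewrite -addrA -opprD subr_le0 (le_trans S1)// lerDl.
rewrite uEF.
have : \sum_(K <= k < n + K) r1 ^+ (2 ^ k) < 4^-1.
  apply: (@le_lt_trans _ _ (\sum_(K <= k < n + K) r1 ^+ k)).
    apply: ler_sum => k _; apply: ler_wiXn2l => //; first exact: ltW.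
    exact/ltnW/ltn_expl.
  apply: le_lt_trans (geometric_sum_le _ _ r1b) _.
  rewrite ltr_pdivrMr ?subr_gt0// mulrC; apply: le_lt_trans K1P.
  by apply: ler_wiXn2l => //; [exact: ltW|exact: leq_maxl].
have : r2 ^+ (2 ^ (n + K)) < 4^-1.
  apply: le_lt_trans K2P; apply: ler_wiXn2l => //; first exact: ltW.
  apply: leq_trans (leq_maxr K1 K2) _; apply: leq_trans (leq_addl n _) _.
  exact/ltnW/ltn_expl.
move: (r2 ^+ _) (\sum_(_ <= _ < _) _) => x y hx hy.
have -> : 4^-1 = 1 - 4^-1 - 2^-1 :> R by field.
rewrite -!addrA ltrD2l -!opprD ltrN2 (lt_le_trans (ltrD hy hx))//.
by rewrite lerD2l lef_pV2 ?posrE// ler_nat.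
Qed.

End ContinuityForcesLinearity.

(** * Gaussian bounds for conditional moment generating functions *)

Section MomentGeneratingFunctions.
Context {R : realType} {d : measure_display} {T : measurableType d}.
Implicit Types (P : probability T R) (X : nat -> T -> R).

(* The conditional moment generating functions of the increments given the
   past are, near 0, within a factor [1 +- eta] in the exponent of those of a
   centered Gaussian of standard deviation [s]. *)
Definition nearly_gaussian P X (s : R) : Prop :=
  forall eta : R, 0 < eta < 1 -> exists2 l0 : R, 0 < l0 &
    forall a : R, `|a| <= l0 -> forall m G, adapted X m G -> (forall w, 0 <= G w) ->
      expR ((1 - eta) * ((a * s) ^+ 2 / 2)) * \int[P]_w G w <=
        \int[P]_w (G w * expR (a * X m w)) <=
      expR ((1 + eta) * ((a * s) ^+ 2 / 2)) * \int[P]_w G w.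

(** Second order expansion at 0. Half of [eta] absorbs the cubic Taylor remainder; the other half
    absorbs the gap between 1 + z and its exponential, which only the lower bound needs to pay for
    in full. *)
Lemma mgf_bounds P (Y : T -> R) (s M a eta : R) :
  measurable_fun setT Y -> (forall w, `|Y w| <= M) ->
  \int[P]_w Y w = 0 -> \int[P]_w (Y w ^+ 2) = s ^+ 2 ->
  0 < eta < 1 -> `|a| <= 1 -> 8 * (`|a| * M) <= eta -> 2 * (`|a| * s ^+ 2) <= eta ->
  expR ((1 - eta) * ((a * s) ^+ 2 / 2)) <= \int[P]_w expR (a * Y w) <=
  expR ((1 + eta) * ((a * s) ^+ 2 / 2)).
Proof.
move=> mY YM EY EY2 /andP[e0 e1] a1 aM as2.
have hY : inH Y by split => //; exists M.
have hc := @inH_cst R d T.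
have haY : inH (fun w => a * Y w) by exact: inHM.
have hY2 : inH (fun w => Y w ^+ 2) by exact: inHX.
have hE := inH_expR haY.
set u := (a * s) ^+ 2 / 2.
have u0 : 0 <= u by rewrite divr_ge0// sqr_ge0.
have EYc c : \int[P]_w (1 + a * Y w + c * Y w ^+ 2) = 1 + c * s ^+ 2.
  rewrite ExpD//; [|exact: inHD|exact: inHM].
  by rewrite ExpD// Exp_cst !ExpZ// EY EY2 mulr0 addr0.
have hYc c : inH (fun w => 1 + a * Y w + c * Y w ^+ 2).
  by apply: inHD; [exact: inHD|exact: inHM].
(* The remainder 2|aY|^3 is at most (eta/4)(aY)^2 because |aY| <= eta/8. *)
have pt w : `|expR (a * Y w) - (1 + a * Y w + (a * Y w) ^+ 2 / 2)| <=
            eta / 2 * (a ^+ 2 / 2 * Y w ^+ 2).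
  have aYM : `|a * Y w| <= `|a| * M by rewrite normrM ler_wpM2l.
  have aY : `|a * Y w| <= eta / 8 by lra.
  apply: le_trans (expR_taylor2 _) _; first by lra.
  rewrite (_ : 2 * `|a * Y w| ^+ 3 = 2 * `|a * Y w| * `|a * Y w| ^+ 2); last by ring.
  rewrite (_ : eta / 2 * _ = eta / 4 * (a * Y w) ^+ 2); last by field.
  rewrite real_normK ?num_real//; apply: ler_wpM2r; first exact: sqr_ge0.
  by lra.
have lo w : 1 + a * Y w + ((1 - eta / 2) * (a ^+ 2 / 2)) * Y w ^+ 2 <= expR (a * Y w).
  have := pt w; rewrite ler_norml => /andP[+ _].
  rewrite exprMn; lra.
have up w : expR (a * Y w) <= 1 + a * Y w + ((1 + eta / 2) * (a ^+ 2 / 2)) * Y w ^+ 2.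
  have := pt w; rewrite ler_norml => /andP[_].
  rewrite exprMn; lra.
have := le_Exp P (hYc _) hE lo; rewrite EYc.
have := le_Exp P hE (hYc _) up; rewrite EYc.
have uE : a ^+ 2 * s ^+ 2 = 2 * u by rewrite /u exprMn; lra.
have u4 : u <= eta / 4.
  have : a ^+ 2 <= `|a|.
    by rewrite -(real_normK (num_real a)) expr2 ler_piMl.
  move=> h; have : a ^+ 2 * s ^+ 2 <= `|a| * s ^+ 2 by rewrite ler_wpM2r// sqr_ge0.
  lra.
move=> h1 h2; apply/andP; split.
  apply: le_trans h2; set z := (1 - eta) * u.
  have z0 : 0 <= z by rewrite mulr_ge0//; lra.
  have zu : z <= u by rewrite ler_piMl//; lra.
  apply: le_trans (expR_le_quadratic _) _; first by rewrite ger0_norm//; lra.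
  have z2 : z ^+ 2 <= u * (eta / 4).
    by rewrite expr2; apply: ler_pM => //; lra.
  rewrite (_ : _ * s ^+ 2 = (1 - eta / 2) * u); last first.
    by rewrite /u exprMn; field.
  by rewrite /z in z2 *; lra.
apply: le_trans h1 _; apply: le_trans (expR_ge1Dx _).
rewrite (_ : _ * s ^+ 2 = (1 + eta / 2) * u); last first.
  by rewrite /u exprMn; field.
rewrite lerD2l ler_wpM2r//; lra.
Qed.

Lemma adapted_opp X m G : adapted (fun n w => - X n w) m G -> adapted X m G.
Proof.
move=> [[A mA GA] bG]; split => //.
pose r (t : m.-tuple R) := [tuple - tnth t j | j < m].
exists (A \o r).
  apply: measurableT_comp => //; apply/measurable_fun_tnthP => i.
  rewrite (_ : _ \o _ = (fun t : m.-tuple R => - tnth t i)).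
    by apply: measurable_funN; exact: measurable_tnth.
  by apply/funext => t /=; rewrite tnth_mktuple.
move=> w; rewrite GA /=; congr A; apply/eq_from_tnth => i.
by rewrite !tnth_mktuple.
Qed.

Lemma nearly_gaussian_opp P X s : nearly_gaussian P X s ->
  nearly_gaussian P (fun n w => - X n w) s.
Proof.
move=> ng eta etaP; have [l0 l00 H] := ng eta etaP.
exists l0 => // a al0 m G aG G0.
have := H (- a); rewrite normrN => /(_ al0 m G (adapted_opp aG) G0).
rewrite mulNr sqrrN.
by under [\int[_]_w (G w * _)]eq_Rintegral => w _ do rewrite mulNr -mulrN.
Qed.

(** Iteration of the one-step bound: the exponential of the increments already treated is absorbed
    into the weight, which remains adapted and nonnegative. *)
Lemma nearly_gaussian_block P X s : (forall n, inH (X n)) -> nearly_gaussian P X s ->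
  forall eta : R, 0 < eta < 1 -> exists2 l0 : R, 0 < l0 &
    forall a : R, `|a| <= l0 -> forall m L G, adapted X m G -> (forall w, 0 <= G w) ->
      expR ((1 - eta) * ((a * s) ^+ 2 / 2) * L%:R) * \int[P]_w G w <=
        \int[P]_w (G w * expR (a * \sum_(m <= i < m + L) X i w)) <=
      expR ((1 + eta) * ((a * s) ^+ 2 / 2) * L%:R) * \int[P]_w G w.
Proof.
move=> hX ng eta etaP; have [l0 l00 H] := ng eta etaP.
exists l0 => // a al0 m L G aG G0; elim: L => [|L /andP[IH1 IH2]].
  rewrite !mulr0 expR0 !mul1r.
  under [\int[_]_w (G w * _)]eq_Rintegral => w _.
    rewrite addn0 big_geq// mulr0 expR0 mulr1; over.
  by rewrite lexx.
pose G' w := G w * expR (a * \sum_(m <= i < m + L) X i w).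
have mX n : measurable_fun setT (X n) by case: (hX n).
have aG' : adapted X (m + L) G'.
  apply: adaptedM => //; first exact: adaptedW (leq_addr _ _) aG.
  apply: adapted_expR => //; apply: adaptedM => //; first exact: adapted_cst.
  under eq_fun do rewrite big_nat_cond.
  apply: adapted_sum => // i /andP[/andP[_ i_n] _].
  exact: (adapted_comp i_n (@measurable_id _ _ setT) (hX i)).
have G'0 w : 0 <= G' w by rewrite mulr_ge0// expR_ge0.
have := H a al0 _ _ aG' G'0.
rewrite (_ : \int[P]_w (G' w * _) =
  \int[P]_w (G w * expR (a * \sum_(m <= i < m + L.+1) X i w))); last first.
  apply: eq_Rintegral => w _; rewrite /G' addnS big_nat_recr ?leq_addr//=.
  by rewrite mulrDr expRD mulrA.
have e c : expR (c * L.+1%:R) = expR c * expR (c * L%:R) :> R.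
  by rewrite -natr1 mulrDr mulr1 expRD mulrC.
rewrite !e => /andP[h1 h2]; apply/andP; split.
  by apply: le_trans h1; rewrite -[leLHS]mulrA ler_pM2l ?expR_gt0.
by apply: (le_trans h2); rewrite -[leRHS]mulrA ler_pM2l ?expR_gt0.
Qed.

End MomentGeneratingFunctions.

Section PengIsNearlyGaussian.
Context {R : realType} {d : measure_display} {T : measurableType d}.
Variables (Ps : set (probability T R)) (X : nat -> T -> R).
Hypothesis Ps0 : Ps !=set0.
Hypothesis mX : forall n, measurable_fun setT (X n).
Hypothesis bX : forall n, exists M : R, forall w, `|X n w| <= M.
Hypothesis iidX : iid Ps X.

(** Under P the conditional exponential moment lies between the infimum and the supremum over the
    family of the moment of [X 0]. All members share the mean and the variance, so [mgf_bounds]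
    controls both ends uniformly. *)
Lemma peng_nearly_gaussian (s : R) :
  (forall P, Ps P -> \int[P]_w X 0 w = 0) ->
  (forall P, Ps P -> \int[P]_w (X 0 w ^+ 2) = s ^+ 2) ->
  forall P, Ps P -> nearly_gaussian P X s.
Proof.
move=> E1 E2 P PsP eta etaP; have /andP[e0 e1] := etaP.
have [M0 XM0] := bX 0; pose M := `|M0| + 1.
have M1 : 0 < M by rewrite ltr_wpDl.
have XM w : `|X 0 w| <= M.
  by rewrite (le_trans (XM0 w))// (le_trans (ler_norm _))// lerDl.
have s2 : 0 < s ^+ 2 + 1 by rewrite ltr_wpDl// sqr_ge0.
(* The three smallness conditions of [mgf_bounds]; adding 1 to the bound and to s^2 keeps the
   denominators positive. *)
pose l0 := Num.min 1 (Num.min (eta / (8 * M)) (eta / (2 * (s ^+ 2 + 1)))).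
have l00 : 0 < l0 by rewrite !lt_min ltr01 !divr_gt0// mulr_gt0.
exists l0 => // a; rewrite !le_min => /and3P[a1 a2 a3] m G aG G0.
have mgf Q : Ps Q -> expR ((1 - eta) * ((a * s) ^+ 2 / 2)) <=
    \int[Q]_w expR (a * X 0 w) <= expR ((1 + eta) * ((a * s) ^+ 2 / 2)).
  move=> PsQ; apply: (@mgf_bounds _ _ _ Q (X 0) s M) => //; [exact: E1|exact: E2| |].
    by move: a2; rewrite ler_pdivlMr ?mulr_gt0//; lra.
  move: a3; rewrite ler_pdivlMr ?mulr_gt0//.
  by have := normr_ge0 a; lra.
pose h x := expR (a * x).
have mh : measurable_fun setT h.
  by apply: measurableT_comp => //; exact: measurable_funM.
have hh n : inH (h \o X n).
  apply: inH_expR; apply: inHM; first exact: inH_cst.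
  by split => //; exact: bX.
have IG0 : 0 <= \int[P]_w G w by apply: Rintegral_ge0.
apply/andP; split.
  apply: le_trans (cond_Exp_ge Ps0 mX iidX PsP aG G0 mh hh).
  apply: ler_wpM2r => //; rewrite lerNr; apply: uE_le => //.
    exact: (inHN (hh 0%N)).
  move=> Q PsQ; rewrite ExpN; last exact: (hh 0%N).
  by rewrite lerN2; have /andP[] := mgf Q PsQ.
apply: le_trans (cond_Exp_le Ps0 mX iidX PsP aG G0 mh hh) _.
apply: ler_wpM2r => //; apply: uE_le => // Q PsQ.
by have /andP[] := mgf Q PsQ.
Qed.

End PengIsNearlyGaussian.

(** * Upper half: maximal inequality and Borel-Cantelli *)

Section MaximalInequality.
Context {R : realType} {d : measure_display} {T : measurableType d}.
Variables (P : probability T R) (X : nat -> T -> R).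
Hypothesis hX : forall n, inH (X n).
Let mX n : measurable_fun setT (X n). Proof. by case: (hX n). Qed.
Local Notation S n w := (\sum_(i < n) X i w).

Lemma adapted_partial_sum n : adapted X n (fun w => S n w).
Proof.
apply: adapted_sum => // i _.
exact: (adapted_comp (ltn_ord i) (@measurable_id _ _ setT) (hX i)).
Qed.

(** Doob's inequality for the supermartingale [W], without stopping times: [U n] indicates that [W]
    has stayed below [A] up to time n. *)
Lemma maximal_ineq (a kap A : R) N : 1 < A ->
  (forall m G, adapted X m G -> (forall w, 0 <= G w) ->
    \int[P]_w (G w * expR (a * X m w)) <= expR kap * \int[P]_w G w) ->
  (P (\bigcup_(n in [set n | (n <= N)%N]) [set w | (A <= expR (a * S n w - n%:R * kap))%R])
    <= (A^-1)%:E)%E.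
Proof.
move=> A1 H; have A0 : 0 < A by exact: lt_trans A1.
pose W n w := expR (a * S n w - n%:R * kap).
pose U n w : R := \prod_(k < n.+1) (W k w < A)%R%:R.
have aW n : adapted X n (W n).
  apply: adapted_expR => //; apply: adaptedB => //; last exact: adapted_cst.
  by apply: adaptedM => //; [exact: adapted_cst|exact: adapted_partial_sum].
have aU n : adapted X n (U n).
  apply: adapted_prod => // k _; apply: adapted_ltr => //; last exact: adapted_cst.
  by apply: adaptedW (aW k); rewrite -ltnS.
have hW n := adapted_inH mX (aW n); have hU n := adapted_inH mX (aU n).
have W0 n w : 0 <= W n w by exact: expR_ge0.
have U0 n w : 0 <= U n w by apply: prodr_ge0.
have US n w : U n.+1 w = U n w * (W n.+1 w < A)%R%:R by rewrite /U big_ord_recr.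
have U1 n w : U n w <= 1.
  elim: n => [|n IH]; first by rewrite /U big_ord1; case: (_ < _).
  by rewrite US; case: (_ < _); rewrite ?mulr1 ?mulr0.
(* The left side bounds from below the mean of [W] stopped at its first passage above [A], each
   passage being counted as exactly [A]; the start is [W 0] = 1 < [A]. *)
have main n : A * (1 - \int[P]_w U n w) + \int[P]_w (U n w * W n w) <= 1.
  elim: n => [|n IH].
    have e w : U 0 w = 1 by rewrite /U big_ord1 /W big_ord0 mulr0 mul0r subr0 expR0 A1.
    have e' w : U 0 w * W 0 w = 1.
      by rewrite e /W big_ord0 mulr0 mul0r subr0 expR0 mulr1.
    have -> : \int[P]_w U 0 w = 1.
      by rewrite -[RHS](Exp_cst P); apply: eq_Rintegral => w _; exact: e.
    have -> : \int[P]_w (U 0 w * W 0 w) = 1.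
      by rewrite -[RHS](Exp_cst P); apply: eq_Rintegral => w _; exact: e'.
    by rewrite subrr mulr0 add0r.
  have aG : adapted X n (fun w => U n w * W n w) by exact: adaptedM.
  have G0 w : 0 <= U n w * W n w by rewrite mulr_ge0.
  have step : \int[P]_w (U n w * W n.+1 w) <= \int[P]_w (U n w * W n w).
    have := H _ _ aG G0; rewrite mulrC -ler_pdivrMr ?expR_gt0// mulrC.
    rewrite -expRN -ExpZ; last first.
      apply: inHM; first exact: (adapted_inH mX aG).
      by apply: inH_expR; apply: inHM => //; exact: inH_cst.
    apply: le_trans; rewrite le_eqVlt; apply/orP; left; apply/eqP.
    apply: eq_Rintegral => w _; rewrite -mulrA mulrCA; congr (_ * _).
    rewrite /W big_ord_recr/= -!expRD; congr expR.
    by rewrite -natr1; ring.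
  have hUW m k : inH (fun w => U m w * W k w) by exact: inHM.
  have : \int[P]_w (U n.+1 w * W n.+1 w) + A * (\int[P]_w U n w - \int[P]_w U n.+1 w)
       <= \int[P]_w (U n w * W n.+1 w).
    rewrite -ExpB// -ExpZ; last exact: inHB.
    have hAU : inH (fun w => A * (U n w - U n.+1 w)).
      by apply: inHM; [exact: inH_cst|exact: inHB].
    rewrite -ExpD//; apply: le_Exp => //; first exact: inHD.
    move=> w; rewrite US; case: ltP => [_|AW].
      by rewrite mulr1 subrr mulr0 addr0.
    by rewrite mulr0 mul0r add0r subr0 mulrC ler_wpM2l.
  by lra.
set E := (X in P X).
have mE : measurable E.
  apply: bigcup_measurable => n _.
  have mb : measurable_fun setT (fun w => A <= W n w).
    by apply: measurable_fun_ler => //; case: (hW n).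
  by rewrite -[X in measurable X]setTI; exact: mb.
rewrite (Exp_indic P mE) lee_fin.
have : \int[P]_w \1_E w <= \int[P]_w (1 - U N w).
  have c1 := @inH_cst R d T 1.
  apply: le_Exp; [exact: inH_indic|exact: inHB|move=> w].
  rewrite indicE; have [wE|wE] := boolP (w \in E); last by rewrite subr_ge0.
  have [n /= nN An] := set_mem wE.
  have -> : U N w = 0; last by rewrite subr0.
  rewrite /U (bigD1 (Ordinal (nN : (n < N.+1)%N)))//=.
  by rewrite ltNge An mul0r.
rewrite ExpB ?Exp_cst//; last exact: inH_cst.
move=> /le_trans; apply; rewrite -[leRHS]mul1r ler_pdivlMr// mulrC.
have : 0 <= \int[P]_w (U N w * W N w).
  by apply: Rintegral_ge0 => w _; rewrite mulr_ge0.
by have := main N; lra.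
Qed.

End MaximalInequality.

Section UpperHalf.
Context {R : realType} {d : measure_display} {T : measurableType d}.
Variables (P : probability T R) (X : nat -> T -> R) (s : R).
Hypothesis hX : forall n, inH (X n).
Hypothesis s0 : 0 < s.
Hypothesis ng : nearly_gaussian P X s.
Local Notation S n w := (\sum_(i < n) X i w).
Local Notation phi n := (Num.sqrt (2 * n%:R * ln (ln n%:R))).

(** Maximal inequality with the tilt a = sqrt (2l/t)/s and level e^((1+del) l), where l = ln ln t.
    Off the exceptional set, n <= (1+del) t gives a S_n <= (1+del) l + (1+del)^2 l <= 2 (1+del)^2 l,
    and 2l/a is s sqrt (2 t l). *)
Lemma block_upper_tail (del : R) : 0 < del < 1 -> exists2 C : R, expR 1 < C &
  forall (t : R) (N : nat), C <= t -> exists E : set T, [/\ measurable E,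
    (P E <= (expR (- (1 + del) * ln (ln t)))%:E)%E &
    forall w, ~ E w -> forall n, (n <= N)%N -> t <= n%:R <= (1 + del) * t ->
      S n w <= (1 + del) ^+ 2 * s * phi n].
Proof.
move=> delP; have /andP[d0 d1] := delP.
have [l0 l00 H] := ng delP.
have [C C1 HC] := lil_rate_small (mulr_gt0 l00 s0).
exists C => // t N Ct; have t1 : expR 1 < t by exact: lt_le_trans Ct.
have t0 : 0 < t by exact: lt_trans (expR_gt0 _) t1.
pose l := ln (ln t); have ll0 : 0 < l by exact: lnln_gt0.
pose q := Num.sqrt (2 * l / t).
have q0 : 0 < q by rewrite sqrtr_gt0 divr_gt0// mulr_gt0.
have q2 : q ^+ 2 = 2 * l / t by rewrite sqr_sqrtr// divr_ge0 ?mulr_ge0 ?ltW.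
pose a := q / s; have a0 : 0 < a by rewrite divr_gt0.
have al0 : `|a| <= l0 by rewrite gtr0_norm// ler_pdivrMr// HC.
pose kap := (1 + del) * ((a * s) ^+ 2 / 2).
have as2 : (a * s) ^+ 2 = 2 * l / t by rewrite /a divfK ?gt_eqF.
pose A := expR ((1 + del) * l).
have A1 : 1 < A by rewrite expR_gt1 mulr_gt0// addr_gt0.
have Hk m G : adapted X m G -> (forall w, 0 <= G w) ->
    \int[P]_w (G w * expR (a * X m w)) <= expR kap * \int[P]_w G w.
  by move=> aG G0; have /andP[] := H a al0 m G aG G0.
have := maximal_ineq hX N A1 Hk.
set E := (X in P X) => PE; exists E; split.
- apply: bigcup_measurable => n _.
  have mb : measurable_fun setT (fun w => A <= expR (a * S n w - n%:R * kap)).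
    apply: measurable_fun_ler => //.
    have [+ _] : inH (fun w => expR (a * S n w - n%:R * kap)) => //.
    apply: inH_expR; apply: inHB; last exact: inH_cst.
    apply: inHM; first exact: inH_cst.
    exact: inH_sum.
  by rewrite -[X in measurable X]setTI; exact: mb.
- by rewrite mulNr expRN.
- move=> w nE n nN /andP[tn nt].
  have : expR (a * S n w - n%:R * kap) < A.
    by rewrite ltNge; apply/negP => h; apply: nE; exists n.
  rewrite ltr_expR => h.
  apply: (@le_trans _ _ ((1 + del) ^+ 2 * s * Num.sqrt (2 * t * l))); last first.
    by rewrite ler_pM2l ?mulr_gt0 ?exprn_gt0 ?addr_gt0//; exact: lil_norm_ge.
  have -> : Num.sqrt (2 * t * l) = q * t.
    rewrite (_ : 2 * t * l = (q * t) ^+ 2) ?sqrtr_sqr ?gtr0_norm ?mulr_gt0//.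
    by rewrite exprMn q2; field; rewrite gt_eqF.
  have kapE : n%:R * kap <= (1 + del) * ((1 + del) * l).
    rewrite /kap as2 mulrCA ler_pM2l ?addr_gt0//.
    rewrite (_ : n%:R * _ = n%:R * l / t); last by field; rewrite gt_eqF.
    by rewrite ler_pdivrMr// mulrAC ler_pM2r.
  rewrite -(ler_pM2l a0).
  have -> : a * ((1 + del) ^+ 2 * s * (q * t)) = (1 + del) ^+ 2 * (2 * l).
    rewrite (_ : a * _ = (1 + del) ^+ 2 * (q ^+ 2 * t)).
      by rewrite q2 divfK// gt_eqF.
    by rewrite /a; field; rewrite gt_eqF.
  have : 0 < del * l by rewrite mulr_gt0.
  have : 0 < del * (del * l) by rewrite !mulr_gt0.
  move: h kapE; rewrite expr2; lra.
Qed.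

Lemma lil_upper (e : R) : 0 < e ->
  \forall w \ae P, exists N0, forall n, (N0 <= n)%N -> S n w <= (1 + e) * s * phi n.
Proof.
(* Then (1 + del)^2 <= 1 + 3 del <= 1 + e. *)
move=> e0; pose del := Num.min 2^-1 (e / 3).
have del0 : 0 < del by rewrite lt_min invr_gt0 ltr0n/= divr_gt0.
have delh : del <= 2^-1 by rewrite ge_min lexx.
have dele : del <= e / 3 by rewrite ge_min lexx orbT.
have delP : 0 < del < 1 by rewrite del0/=; lra.
have de : (1 + del) ^+ 2 <= 1 + e.
  have : del * del <= del by rewrite ler_piMr ?ltW//; lra.
  by rewrite expr2; lra.
pose th := 1 + del; have th1 : 1 < th by rewrite ltrDl.
have [C C1 HC] := block_upper_tail delP.
have [k0 k0C] : exists k0 : nat, C <= th ^+ k0.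
  by have [K /ltW] := exists_expr_gt C th1; exists K.
pose t (k : nat) := th ^+ (k0 + k).+2.
have tC k : C <= t k.
  by rewrite (le_trans k0C)//; apply: ler_weXn2l; [exact: ltW|rewrite -!addnS leq_addr].
(* A horizon covering every integer of the block from t k to th t k, as the maximal inequality
   concerns finitely many times. *)
pose N (k : nat) := (Num.truncn (th * t k)).+1.
have [E HE] := choice (fun k => HC (t k) (N k) (tC k)).
have mE k : measurable (E k) by have [] := HE k.
have [c cP] := summable_blocks k0 th1 del0.
have lim0 : P (lim_sup_set E) = 0%E.
  apply: lim_sup_set_cvg0 => //; apply: (@nneseries_le _ _ c) => // n.
  apply: (@le_trans _ _ (\sum_(0 <= k < n) (expR (- (1 + del) * ln (ln (t k))))%:E)%E).
    by apply: lee_sum => k _; have [] := HE k.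
  by rewrite sumEFin lee_fin.
exists (lim_sup_set E); split => //.
  by apply: bigcap_measurableType => n _; exact: bigcup_measurable.
move=> w /=; apply: contra_notP => nlim.
have [K HK] : exists K, forall k, (K <= k)%N -> ~ E k w.
  apply: contrapT => h; apply: nlim => n _; apply: contrapT => h2; apply: h.
  by exists n => k nk Ek; apply: h2; exists k.
pose N0 := (Num.truncn (t K)).+1.
have tN0 : t K < N0%:R by exact: Num.Theory.truncnS_gt.
exists N0 => n N0n.
have n0 : (0 < n)%N by apply: leq_trans N0n.
have tKn : t K < n%:R by apply: (lt_le_trans tN0); rewrite ler_nat.
have [j /andP[j1 j2]] := exists_block th1 n0.
have jK : ((k0 + K).+2 <= j)%N.
  rewrite leqNgt; apply/negP => jk.
  have : th ^+ j.+1 <= t K by apply: ler_weXn2l => //; exact: ltW.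
  by move=> h; have := lt_trans (lt_le_trans j2 h) tKn; rewrite ltxx.
pose k := (j - (k0.+2))%N.
have k0j : (k0.+2 <= j)%N by apply: leq_trans jK; rewrite !ltnS leq_addr.
have jE : j = (k0 + k).+2 by rewrite /k -!addSn subnKC.
have Kk : (K <= k)%N by rewrite /k leq_subRL.
have [_ _] := HE k; move=> /(_ w (HK k Kk) n).
have nth : n%:R <= th * t k by rewrite /t -exprS -jE ltW.
move=> h; apply: (le_trans (h _ _)).
- rewrite -(ler_nat R) (le_trans nth)// ltW//; exact: Num.Theory.truncnS_gt.
- by rewrite nth andbT /t -jE.
- by rewrite !ler_wpM2r// ?sqrtr_ge0// ltW.
Qed.

End UpperHalf.

(** * Lower half: exponential tilting on geometric blocks *)

Section LowerHalf.
Context {R : realType} {d : measure_display} {T : measurableType d}.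
Variables (P : probability T R) (X : nat -> T -> R) (s : R).
Hypothesis hX : forall n, inH (X n).
Hypothesis s0 : 0 < s.
Hypothesis ng : nearly_gaussian P X s.
Let mX n : measurable_fun setT (X n). Proof. by case: (hX n). Qed.
Local Notation S n w := (\sum_(i < n) X i w).
Local Notation phi n := (Num.sqrt (2 * n%:R * ln (ln n%:R))).

Lemma adapted_block_sum m n : adapted X n (fun w => \sum_(m <= i < n) X i w).
Proof.
under eq_fun do rewrite big_nat_cond.
apply: adapted_sum => // i /andP[/andP[_ i_n] _].
exact: (adapted_comp i_n (@measurable_id _ _ setT) (hX i)).
Qed.

(** Kolmogorov's lower exponential bound, conditionally on the past through [G]. It is stated for
    the mass of failure so that successive blocks multiply. The tilts by (1 - del) a, a and (1 +
    del) a enter, whence the condition on (1 + del) a. *)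
Lemma block_lower_tail (del : R) : 0 < del <= 4^-1 ->
  exists l0 x0 : R, 0 < l0 /\ forall (a : R) (m L : nat) G,
    0 < a -> (1 + del) * a <= l0 -> x0 <= (a * s) ^+ 2 * L%:R ->
    adapted X m G -> (forall w, 0 <= G w) ->
    \int[P]_w (G w * (\sum_(m <= i < m + L) X i w <
                       (1 - del) * (a * s ^+ 2 * L%:R))%R%:R) <=
    (1 - 2^-1 * expR (- (1 + 4 * del) * ((a * s) ^+ 2 * L%:R / 2))) * \int[P]_w G w.
Proof.
move=> delP; have /andP[d0 d4] := delP; pose eta := del ^+ 2 / 10.
have [etaP _ _ _] := tilting_exponents delP (lexx _).
have [l0 l00 H] := nearly_gaussian_block hX ng etaP.
exists l0, (4 * ln 4 / del ^+ 2); split=> // a m L G a0 al0 xx0 aG G0.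
set x := (a * s) ^+ 2 * L%:R in xx0 *.
have x0 : 0 <= x by rewrite mulr_ge0 ?sqr_ge0.
pose B w := \sum_(m <= i < m + L) X i w.
pose I := \int[P]_w G w; have I0 : 0 <= I by exact: Rintegral_ge0.
have hG := adapted_inH mX aG.
have hB : inH B := adapted_inH mX (adapted_block_sum m (m + L)).
have hc := @inH_cst R d T.
have hE c : inH (fun w => expR (c * B w)) by apply: inH_expR; exact: inHM.
have hGE c : inH (fun w => G w * expR (c * B w)) by exact: inHM.
have norm_le c : 0 <= c -> c <= 1 + del -> `|c * a| <= l0.
  move=> c0 c1; rewrite ger0_norm; last by apply: mulr_ge0 => //; exact: ltW.
  by apply: le_trans al0; rewrite ler_pM2r.
have up c : 0 <= c -> c <= 1 + del ->
    \int[P]_w (G w * expR (c * a * B w)) <= expR ((1 + eta) * (c ^+ 2 * x / 2)) * I.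
  move=> c0 c1; have /andP[_] := H _ (norm_le c c0 c1) m L G aG G0.
  move=> /le_trans; apply; rewrite le_eqVlt; apply/orP; left; apply/eqP.
  by congr (expR _ * _); rewrite /x /eta; ring.
have lo : expR ((1 - eta) * (x / 2)) * I <= \int[P]_w (G w * expR (a * B w)).
  have l1 : `|a| <= l0 by rewrite -[a]mul1r norm_le// lerDl ltW.
  have /andP[+ _] := H a l1 m L G aG G0.
  apply: le_trans; rewrite le_eqVlt; apply/orP; left; apply/eqP.
  by congr (expR _ * _); rewrite /x /eta; ring.
pose thr := (1 - del) * (a * s ^+ 2 * L%:R).
have bigE w : (B w < thr) = (a * B w < (1 - del) * x).
  rewrite -(ltr_pM2l a0); congr (_ < _).
  by rewrite /thr /x; ring.
pose J := \int[P]_w (G w * (B w < thr)%R%:R).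
have hJ : inH (fun w => G w * (B w < thr)%R%:R) by apply: inHM => //; exact: inH_ltr.
pose A1 := expR ((1 + del) * x).
pose A2 := expR (del * (1 - del) * x).
pose A3 := expR (- (del * (1 + del) * x)).
have main : \int[P]_w (G w * expR (a * B w)) <= A1 * (I - J) +
   (A2 * \int[P]_w (G w * expR ((1 - del) * a * B w)) +
    A3 * \int[P]_w (G w * expR ((1 + del) * a * B w))).
  have h1 : inH (fun w => A1 * (G w - G w * (B w < thr)%R%:R)).
    by apply: inHM => //; exact: inHB.
  have h2 : inH (fun w => A2 * (G w * expR ((1 - del) * a * B w))) by exact: inHM.
  have h3 : inH (fun w => A3 * (G w * expR ((1 + del) * a * B w))) by exact: inHM.
  rewrite -ExpB// -ExpZ; last exact: inHB.
  rewrite -!ExpZ// -ExpD// -ExpD//; last exact: inHD.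
  apply: le_Exp => //; first by apply: inHD => //; exact: inHD.
  move=> w; have := ler_wpM2l (G0 w) (tilting_window x (a * B w) d0).
  move=> /le_trans; apply; rewrite le_eqVlt; apply/orP; left; apply/eqP.
  by rewrite bigE -/A1 -/A2 -/A3 !mulrA; ring.
have [_ k1 k2 k3] := tilting_exponents delP xx0.
apply: (tilting_combine (expR_gt0 _) I0 lo main _ _ k3).
- apply: (@le_trans _ _ (A2 * (expR ((1 + eta) * ((1 - del) ^+ 2 * x / 2)) * I))).
    rewrite ler_pM2l ?expR_gt0//; apply: up.
      by rewrite subr_ge0 (le_trans d4)// invf_le1// ler1n.
    by rewrite lerD2l (le_trans _ (ltW d0))// oppr_le0 ltW.
  by rewrite mulrA ler_wpM2r.
- apply: (@le_trans _ _ (A3 * (expR ((1 + eta) * ((1 + del) ^+ 2 * x / 2)) * I))).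
    rewrite ler_pM2l ?expR_gt0//; apply: up => //.
    by rewrite addr_ge0// ltW.
  by rewrite mulrA ler_wpM2r.
Qed.

End LowerHalf.

Section LowerHalfConclusion.
Context {R : realType} {d : measure_display} {T : measurableType d}.
Variables (P : probability T R) (X : nat -> T -> R) (s : R).
Hypothesis hX : forall n, inH (X n).
Hypothesis s0 : 0 < s.
Hypothesis ng : nearly_gaussian P X s.
Let mX n : measurable_fun setT (X n). Proof. by case: (hX n). Qed.
Local Notation S n w := (\sum_(i < n) X i w).
Local Notation phi n := (Num.sqrt (2 * n%:R * ln (ln n%:R))).

(** The indicator of failure on the blocks from K to n - 1 serves as the weight for block n, so its
    mean is at most the product of the factors 1 - 1/(2k), hence at most (K/n)^(1/2), which tends to
    0. *)
Lemma blocks_exceed_io (b : nat -> nat) (thr : nat -> R) (k1 : nat) :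
  (0 < k1)%N -> {homo b : m n / (m <= n)%N} ->
  (forall k G, (k1 <= k)%N -> adapted X (b k) G -> (forall w, 0 <= G w) ->
    \int[P]_w (G w * (\sum_(b k <= i < b k.+1) X i w < thr k)%R%:R) <=
    (1 - 2^-1 * k%:R^-1) * \int[P]_w G w) ->
  \forall w \ae P, forall K, exists2 k, (K <= k)%N & thr k <= \sum_(b k <= i < b k.+1) X i w.
Proof.
move=> k10 bmono H.
pose B k w := \sum_(b k <= i < b k.+1) X i w.
suff suf K : (k1 <= K)%N -> \forall w \ae P, exists2 k, (K <= k)%N & thr k <= B k w.
  have : \forall w \ae P, forall K, exists2 k, (K + k1 <= k)%N & thr k <= B k w.
    by apply: ae_foralln => K; apply: suf; exact: leq_addl.
  apply: filterS => w h K; have [k Kk hk] := h K.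
  by exists k => //; apply: leq_trans Kk; exact: leq_addr.
move=> k1K.
have K0 : (0 < K)%N by exact: leq_trans k1K.
have hB k : inH (B k) := adapted_inH mX (adapted_block_sum hX (b k) (b k.+1)).
pose G n w : R := \prod_(K <= k < n) (B k w < thr k)%R%:R.
have aG n : adapted X (b n) (G n).
  rewrite /G; under eq_fun do rewrite big_nat_cond.
  apply: adapted_prod => // k /andP[/andP[_ kn] _].
  apply: adapted_ltr => //; last exact: adapted_cst.
  by apply: adaptedW (adapted_block_sum hX _ _) => //; exact: bmono.
have G0 n w : 0 <= G n w by apply: prodr_ge0.
have decay n : (K <= n)%N -> \int[P]_w G n w <= expR (2^-1 * (ln K%:R - ln n%:R)).
  elim: n => [|n IH]; first by rewrite leqn0 => /eqP K00; rewrite K00 in K0.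
  rewrite leq_eqVlt => /predU1P[e|].
    rewrite e subrr mulr0 expR0 -[leRHS](Exp_cst P).
    rewrite le_eqVlt; apply/orP; left; apply/eqP.
    by apply: eq_Rintegral => w _; rewrite /G big_geq// e.
  rewrite ltnS => Kn; have n0 : 0 < n%:R :> R by rewrite ltr0n (leq_trans K0).
  have GS w : G n.+1 w = G n w * (B n w < thr n)%R%:R by rewrite /G big_nat_recr.
  under eq_Rintegral => w _ do rewrite GS.
  apply: le_trans (H n _ (leq_trans k1K Kn) (aG n) (G0 n)) _.
  have IG0 : 0 <= \int[P]_w G n w by exact: Rintegral_ge0.
  have nV : 0 < n%:R^-1 :> R by rewrite invr_gt0.
  have lnS : ln n.+1%:R - ln n%:R <= n%:R^-1 :> R.
    have -> : n.+1%:R = n%:R * (1 + n%:R^-1) :> R.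
      by rewrite -natr1; field; rewrite gt_eqF.
    rewrite lnM ?posrE ?addr_gt0// addrAC subrr add0r.
    by apply: le_ln1Dx; apply: lt_trans nV; rewrite ltrN10.
  apply: (@le_trans _ _ (expR (- (2^-1 * n%:R^-1)) * \int[P]_w G n w)).
    by rewrite ler_wpM2r// (le_trans _ (expR_ge1Dx _)).
  rewrite (_ : 2^-1 * (ln K%:R - ln n.+1%:R) =
    2^-1 * (ln n%:R - ln n.+1%:R) + 2^-1 * (ln K%:R - ln n%:R)); last by ring.
  rewrite expRD; apply: ler_pM; [exact: expR_ge0|exact: IG0|rewrite ler_expR|exact: IH].
  by rewrite -mulrN ler_pM2l ?invr_gt0// lerNl opprB.
pose A := \bigcap_(k in [set k | (K <= k)%N]) [set w | B k w < thr k].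
have mA : measurable A.
  apply: bigcap_measurableType => k _.
  have mb : measurable_fun setT (fun w => B k w < thr k).
    by apply: measurable_fun_ltr => //; case: (hB k).
  by rewrite -[X in measurable X]setTI; exact: mb.
exists A; split => //; last first.
  move=> w /= nex k /= Kk; rewrite /= ltNge; apply/negP => h; apply: nex.
  by exists k.
have PA n : (K <= n)%N -> \int[P]_w \1_A w <= expR (2^-1 * (ln K%:R - ln n%:R)).
  move=> Kn; apply: le_trans (decay n Kn); apply: le_Exp.
  - exact: inH_indic.
  - exact: (adapted_inH mX (aG n)).
  move=> w; rewrite indicE; have [wA|wA] := boolP (w \in A); last exact: G0.
  rewrite /G big_nat_cond big1// => k /andP[/andP[Kk _] _].
  by have /= -> := set_mem wA k Kk.
rewrite (Exp_indic _ mA); congr (_%:E); apply/eqP; rewrite eq_le.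
rewrite [X in _ && X]Rintegral_ge0 ?andbT; last by move=> w _; rewrite indicE.
rewrite leNgt; apply/negP => p0; set p := \int[P]_w _ in p0 PA.
(* This is K / p^2: beyond it (K/n)^(1/2) is smaller than [p], a contradiction. *)
pose y := expR (ln K%:R - 2 * ln p).
pose n := maxn K (Num.truncn y).+1.
have yn : y < n%:R by apply: lt_le_trans (truncnS_gt _) _; rewrite ler_nat leq_maxr.
have := PA n (leq_maxl _ _); rewrite -[p in p <= _]lnK ?posrE// ler_expR.
have : ln K%:R - 2 * ln p < ln n%:R.
  rewrite -[ltLHS]expRK ltr_ln ?posrE ?expR_gt0//.
  exact: lt_trans (expR_gt0 _) yn.
lra.
Qed.

(** S at q^(k+1) is S at q^k plus a block sum. Infinitely many blocks are large, and the upper half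
    for -X bounds the initial part from below by -2 s phi(q^k), negligible for large q. *)
Lemma lil_lower (e : R) : 0 < e <= 1 -> \forall w \ae P, forall N, exists2 n,
  (N <= n)%N & (1 - e) * s * phi n <= S n w.
Proof.
(* The block threshold loses 7 del and the initial part 2 del, the factor 2 coming from the upper
   half taken with e = 1. *)
move=> /andP[e0 e1]; pose del := e / 9.
have d0 : 0 < del by rewrite /del; lra.
have d9 : del <= 9^-1 by rewrite /del; lra.
have delP4 : 0 < del <= 4^-1 by apply/andP; split; lra.
have delP9 : 0 < del <= 9^-1 by rewrite d0.
(* q > e makes ln ln q positive, and 1/q <= del^2 gives phi(q^k) <= del phi(q^(k+1)). *)
pose q := (Num.truncn (expR 1 + (del ^+ 2)^-1)).+1.
have qlt : expR 1 + (del ^+ 2)^-1 < q%:R by exact: truncnS_gt.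
have d20 : 0 < (del ^+ 2)^-1 by rewrite invr_gt0 exprn_gt0.
have eq : expR 1 < q%:R :> R by apply: lt_trans qlt; rewrite ltrDl.
have q0 : 0 < q%:R :> R by rewrite ltr0n.
have q1 : (1 < q)%N by rewrite -(ltr1n R) (lt_trans _ eq)// expR_gt1.
have qd2 : q%:R^-1 <= del ^+ 2.
  rewrite -[leRHS]invrK lef_pV2 ?posrE// ltW// (lt_trans _ qlt)//.
  by rewrite ltrDr expR_gt0.
have qd : q%:R^-1 <= del.
  by apply: le_trans qd2 _; rewrite expr2 ler_piMl ?ltW//; lra.
have [l0 [x0 [l00 tail]]] := block_lower_tail hX ng delP4.
have [k1 scales] := lower_block_scales x0 s0 l00 delP9 eq qd.
pose x k : R := 2 * ln k%:R / (1 + 4 * del).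
pose L k : R := q%:R ^+ k * (q%:R - 1).
pose a k := Num.sqrt (x k / L k) / s.
pose thr k := (1 - del) * (a k * s ^+ 2 * L k).
have Lnat k : L k = (q ^ k * (q - 1))%:R.
  by rewrite /L natrM natrX natrB// ltnW.
have bE k : (q ^ k.+1 = q ^ k + q ^ k * (q - 1))%N.
  by rewrite expnS -mulnS subn1 prednK ?(ltnW q1)// mulnC.
have k1S : (0 < k1.+1)%N by [].
have bm : {homo (fun k => q ^ k)%N : m n / (m <= n)%N}.
  by move=> m n mn; rewrite leq_exp2l.
have H1 k G : (k1.+1 <= k)%N -> adapted X (q ^ k) G -> (forall w, 0 <= G w) ->
    \int[P]_w (G w * (\sum_(q ^ k <= i < q ^ k.+1) X i w < thr k)%R%:R) <=
    (1 - 2^-1 * k%:R^-1) * \int[P]_w G w.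
  move=> k1k aG G0.
  have [k0 a0 al [xx0 xE] _] := scales k (ltnW k1k).
  have := tail (a k) (q ^ k)%N (q ^ k * (q - 1))%N G a0 al.
  rewrite -bE -Lnat xE => /(_ xx0 aG G0); rewrite -/(thr k).
  (* The exponent (1 + 4 del) x / 2 is exactly ln k by the choice of [x k]. *)
  rewrite (_ : expR _ = k%:R^-1)//.
  rewrite (_ : _ * _ = - ln k%:R); last first.
    by rewrite /=; field; rewrite gt_eqF//; lra.
  by rewrite expRN lnK// posrE ltr0n.
have io := blocks_exceed_io k1S bm H1.
have up := lil_upper (fun n => inHN (hX n)) s0 (nearly_gaussian_opp ng) ltr01.
apply: filterS2 io up => w io [N0 up] N.
have [k Kk thrk] := io (maxn k1 (maxn N N0)).
move: Kk; rewrite !geq_max => /and3P[k1k Nk N0k].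
have kqk j : (j <= q ^ j)%N by apply/ltnW/ltn_expl.
exists (q ^ k.+1)%N; first by apply: leq_trans (kqk _); exact: ltnW.
have {}up := up (q ^ k)%N (leq_trans N0k (kqk k)).
have [k0 a0 al _] := scales k k1k; rewrite -/(x k) -/(L k) -/(a k) -/(thr k) => thrP.
have SE : S (q ^ k.+1) w = S (q ^ k) w + \sum_(q ^ k <= i < q ^ k.+1) X i w.
  by rewrite -!(big_mkord predT (fun i => X i w)) -big_cat_nat//= leq_exp2l.
have phi_ratio : phi (q ^ k)%N <= del * phi (q ^ k.+1)%N.
  rewrite -[del](ger0_norm (ltW d0)) -sqrtr_sqr -sqrtrM ?sqr_ge0//.
  have qk1 : 1 < (q ^ k)%:R :> R by rewrite ltr1n (leq_ltn_trans k0)// ltn_expl.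
  have ll : ln (ln (q ^ k)%:R) <= ln (ln (q ^ k.+1)%:R) :> R.
    by apply: le_lnln => //; rewrite ler_nat leq_exp2l.
  have eqk : expR 1 < (q ^ k.+1)%:R :> R.
    apply: lt_le_trans eq _; rewrite ler_nat -{1}(expn1 q) leq_exp2l//.
  have ll0 := lnln_gt0 eqk.
  apply: ler_wsqrtr.
  apply: (@le_trans _ _ (2 * (q ^ k)%:R * ln (ln (q ^ k.+1)%:R))).
    by rewrite ler_pM2l// mulr_gt0// (lt_trans _ qk1).
  rewrite mulrA ler_pM2r// mulrCA ler_pM2l// expnS natrM mulrA ler_peMl// ?ler0n//.
  by rewrite -ler_pdivrMr// mul1r.
have phiE : Num.sqrt (2 * q%:R ^+ k.+1 * ln (ln ((q%:R : R) ^+ k.+1))) = phi (q ^ k.+1)%N.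
  by rewrite natrX.
rewrite phiE in thrP; rewrite SE sumrN in up *.
have ph0 : 0 <= phi (q ^ k.+1)%N :> R by exact: sqrtr_ge0.
set p1 : R := phi (q ^ k.+1)%N in phi_ratio thrP ph0 *; set p0 : R := phi (q ^ k)%N in up phi_ratio.
have : s * p0 <= s * (del * p1) by rewrite ler_pM2l.
have eE : e = 9 * del by rewrite /del; field.
rewrite eE; lra.
Qed.

End LowerHalfConclusion.

(** * Deterministic sequences: limsup, liminf and limit points *)

Section DeterministicSequences.
Context {R : realType}.
Implicit Types (x z : nat -> R) (r s : R).
Local Notation phi n := (@Num.sqrt R (2 * n%:R * ln (ln n%:R))).

Lemma exists_inv_lt (e : R) : 0 < e -> exists j : nat, j.+1%:R^-1 < e.
Proof.
move=> e0; exists (Num.truncn e^-1).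
by rewrite -[ltRHS]invrK ltf_pV2 ?posrE ?invr_gt0 ?ltr0n// truncnS_gt.
Qed.

Lemma limn_esup_le (u : nat -> \bar R) c N :
  (forall n, (N <= n)%N -> (u n <= c)%E) -> (limn_esup u <= c)%E.
Proof.
move=> uc; rewrite /limn_esup limf_esupE.
apply: (@le_trans _ _ (ereal_sup [set u n | n in [set n | (N <= n)%N]])).
  by apply: ereal_inf_lbound; exists [set n | (N <= n)%N] => //; exists N.
by apply: ge_ereal_sup => _ [n /= Nn <-]; exact: uc.
Qed.

Lemma limn_esup_ge (u : nat -> \bar R) c :
  (forall N, exists2 n, (N <= n)%N & (c <= u n)%E) -> (c <= limn_esup u)%E.
Proof.
move=> uc; rewrite /limn_esup limf_esupE.
apply: le_ereal_inf_tmp => _ [V [N _ NV] <-].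
have [n Nn cn] := uc N; apply: (le_trans cn).
by apply: ereal_sup_ubound; exists n => //; exact: NV.
Qed.

Lemma limn_einf_opp (z : nat -> R) :
  limn_einf (fun n => (z n)%:E) = (- limn_esup (fun n => (- z n)%:E))%E.
Proof.
have <- : -%E \o (fun n => (z n)%:E) = (fun n => (- z n)%:E) by apply/funext.
by rewrite limn_esupN oppeK.
Qed.

(** Only countable quantifiers occur, so that for a random sequence the corresponding event is
    visibly measurable. *)
Definition seq_limit_point z r : Prop :=
  forall j N, exists2 n, (N <= n)%N & `|z n - r| < j.+1%:R^-1.

Lemma clusterP z r : cluster (z n @[n --> \oo]) r <-> seq_limit_point z r.
Proof.
split=> [h j N|h A B [N _ NA] /nbhs_ballP[e /= e0 eB]].
- have e0 : 0 < j.+1%:R^-1 :> R by rewrite invr_gt0 ltr0n.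
  have [|_ [[n /= Nn <-] ]] := h [set z n | n in [set n | (N <= n)%N]] (ball r j.+1%:R^-1) _ (nbhsx_ballx r _ e0).
    by exists N => // n Nn; exists n.
  by rewrite /ball/= distrC => nr; exists n.
- have [j je] := exists_inv_lt e0; have [n Nn nr] := h j N.
  exists (z n); split; first exact: NA.
  by apply: eB; rewrite /ball/= distrC (lt_trans nr).
Qed.

Lemma seq_limit_point_closed z r : (forall e : R, 0 < e -> exists2 r', seq_limit_point z r' & `|r' - r| < e) ->
  seq_limit_point z r.
Proof.
move=> h j N; have e0 : 0 < j.+1%:R^-1 / 2 :> R by rewrite divr_gt0 ?invr_gt0 ?ltr0n.
have [r' lr' rr'] := h _ e0; have [i ie] := exists_inv_lt e0.
have [n Nn nr'] := lr' i N; exists n => //.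
rewrite -(subrKA r') (le_lt_trans (ler_normD _ _))// [ltRHS]splitr.
by rewrite ltrD// (lt_trans nr').
Qed.

Lemma seq_limit_point_le_esup z r : seq_limit_point z r -> (r%:E <= limn_esup (fun n => (z n)%:E))%E.
Proof.
move=> lr; apply/lee_addgt0Pr => e e0; rewrite -leeBlDr// -EFinB.
have [j je] := exists_inv_lt e0; apply: limn_esup_ge => N.
have [n Nn nr] := lr j N; exists n => //; rewrite lee_fin.
have : `|z n - r| < e by exact: lt_trans je.
by rewrite ltr_norml => /andP[+ _]; rewrite ltrBrDr addrC => /ltW.
Qed.

Lemma seq_limit_point_opp z r : seq_limit_point z r <-> seq_limit_point (fun n => - z n) (- r).
Proof.
have aux z' r' : seq_limit_point z' r' -> seq_limit_point (fun n => - z' n) (- r').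
  by move=> h j N; have [n Nn hn] := h j N; exists n; rewrite // -opprD normrN.
split; first exact: aux.
by move=> /aux; rewrite opprK; under eq_fun do rewrite opprK.
Qed.

Lemma seq_limit_point_ge_einf z r : seq_limit_point z r -> (limn_einf (fun n => (z n)%:E) <= r%:E)%E.
Proof.
move=> /seq_limit_point_opp/seq_limit_point_le_esup.
by rewrite limn_einf_opp leeNl EFinN.
Qed.

(** Turns the equality of sets into countably many conditions, which yields measurability of the
    event in (III). Forward: limit points form a closed set, so s and -s are limit points; being
    outside the open interval, they must be the limsup and the liminf. Backward: closedness extends
    the rational levels to all real ones. *)
Lemma limit_set_itv z s : 0 < s ->
  [set r | cluster (z n @[n --> \oo]) r /\ r%:E <> limn_esup (fun n => (z n)%:E) /\
           r%:E <> limn_einf (fun n => (z n)%:E)] = `]- s, s[%classic <->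
  [/\ limn_esup (fun n => (z n)%:E) = s%:E, limn_einf (fun n => (z n)%:E) = (- s)%:E &
      forall q : rat, - s < ratr q < s -> seq_limit_point z (ratr q)].
Proof.
move=> s0; set LS := limn_esup _; set LI := limn_einf _.
split=> [C|[LSs LIs qP]].
- have inC r : - s < r < s -> seq_limit_point z r.
    by move=> rs; have : `]- s, s[%classic r by []; rewrite -C => -[/clusterP].
  have ls : seq_limit_point z s.
    apply: seq_limit_point_closed => e e0; pose m := Num.min (e / 2) s.
    have m0 : 0 < m by rewrite lt_min s0 divr_gt0.
    have ms : m <= s by rewrite ge_min lexx orbT.
    have me : m < e.
      have : m <= e / 2 by rewrite ge_min lexx.
      by lra.
    exists (s - m); first by apply: inC; apply/andP; split; lra.
    by rewrite addrAC subrr add0r normrN gtr0_norm.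
  have lNs : seq_limit_point z (- s).
    apply: seq_limit_point_closed => e e0; pose m := Num.min (e / 2) s.
    have m0 : 0 < m by rewrite lt_min s0 divr_gt0.
    have ms : m <= s by rewrite ge_min lexx orbT.
    have me : m < e.
      have : m <= e / 2 by rewrite ge_min lexx.
      by lra.
    exists (- s + m); first by apply: inC; apply/andP; split; lra.
    by rewrite addrAC subrr add0r gtr0_norm.
  have end_pt r : seq_limit_point z r -> ~~ (- s < r < s) -> r%:E = LS \/ r%:E = LI.
    move=> lr nr; apply: contrapT => /not_orP[h1 h2].
    by move/negP: nr; apply; have : `]- s, s[%classic r by rewrite -C; split; [exact/clusterP|].
  have LIS : (LI <= LS)%E by exact: limn_einf_sup.
  have [|e1|e1] := end_pt s ls; first by rewrite ltxx andbF.
  + have [|e2|e2] := end_pt (- s) lNs; first by rewrite ltxx.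
    * by move: e2; rewrite -e1 => -[] e2; move: s0; rewrite -e2; lra.
    * by split => // q qs; exact: inC.
  + have [|e2|e2] := end_pt (- s) lNs; first by rewrite ltxx.
    * by move: LIS; rewrite -e1 -e2 lee_fin; lra.
    * by move: e2; rewrite -e1 => -[] e2; move: s0; rewrite -e2; lra.
- apply/seteqP; split => r /=.
  + move=> [/clusterP lr [h1 h2]]; rewrite in_itv/= !lt_neqAle.
    have := seq_limit_point_le_esup lr; have := seq_limit_point_ge_einf lr.
    rewrite -/LS -/LI LSs LIs !lee_fin => -> ->; rewrite !andbT.
    apply/andP; split; apply/eqP => e.
      by apply: h2; rewrite LIs e.
    by apply: h1; rewrite LSs e.
  + rewrite in_itv/= => /andP[r1 r2]; split; last first.
      by split; [rewrite LSs|rewrite LIs] => -[] e; move: r1 r2; rewrite e ltxx.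
    apply/clusterP; apply: seq_limit_point_closed => e e0.
    have : r < Num.min s (r + e) by rewrite lt_min r2 ltrDl.
    move=> /rat_in_itvoo[q]; rewrite in_itv/= lt_min => /and3P[rq qs qe].
    exists (ratr q); first by apply: qP; rewrite qs (lt_trans r1).
    by rewrite gtr0_norm ?subr_gt0// ltrBlDl.
Qed.

Lemma lil_normalizer_large (C : R) : exists N : nat, forall n, (N <= n)%N ->
  [/\ C < phi n, 0 < phi n & phi n <= phi n.+1].
Proof.
pose D := `|C| + 1; have D0 : 0 < D by rewrite ltr_wpDl.
(* n > e^e gives ln ln n > 1, so phi(n)^2 exceeds n, which exceeds D^2. *)
exists (Num.truncn (expR (expR 1) + D ^+ 2)).+1 => n Nn.
have bn : expR (expR 1) + D ^+ 2 < n%:R.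
  by apply: lt_le_trans (truncnS_gt _) _; rewrite ler_nat.
have een : expR (expR 1) < n%:R :> R by apply: le_lt_trans bn; rewrite lerDl sqr_ge0.
have n0 : 0 < n%:R :> R by exact: lt_trans (expR_gt0 _) een.
have Dn : D ^+ 2 < n%:R by apply: le_lt_trans bn; rewrite lerDr expR_ge0.
have ln1 : expR 1 < ln n%:R :> R by rewrite -[ltLHS]expRK ltr_ln ?posrE ?expR_gt0.
have ll1 : 1 < ln (ln n%:R) :> R.
  by rewrite -[ltLHS]expRK ltr_ln ?posrE ?expR_gt0// (lt_trans _ ln1)// expR_gt0.
have en : expR 1 < n%:R :> R by exact: lt_trans (ln_sublinear n0).
have Dphi : D < phi n.
  rewrite -[D](gtr0_norm D0) -sqrtr_sqr ltr_sqrt; last first.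
    by rewrite !mulr_gt0// (lt_trans ltr01).
  apply: (lt_trans Dn); rewrite mulrAC.
  by rewrite ltr_pMl// (lt_trans (_ : 1 < 2)) ?ltr1n// ltr_pMr.
split.
- by apply: le_lt_trans Dphi; rewrite (le_trans (ler_norm C))// lerDl.
- exact: lt_trans Dphi.
- by apply: lil_norm_ge => //; rewrite ler_nat.
Qed.

(** The one-sided law for the limsup, with tolerances 1/(j+1) so that it is a countable conjunction
    of almost sure statements. *)
Definition lil_half (x : nat -> R) s : Prop :=
  (forall j, exists N0, forall n, (N0 <= n)%N ->
     \sum_(i < n) x i <= (1 + j.+1%:R^-1) * s * phi n) /\
  (forall j N, exists2 n, (N <= n)%N & (1 - j.+1%:R^-1) * s * phi n <= \sum_(i < n) x i).

Lemma lil_half_ge x s (c : R) : lil_half x s -> c < s -> 0 < s -> forall N, exists2 n, (N <= n)%N &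
  c < (\sum_(i < n) x i) / phi n.
Proof.
move=> [_ lo] cs s0 N; have [N1 N1P] := lil_normalizer_large 0.
have e0 : 0 < (s - c) / s by rewrite divr_gt0// subr_gt0.
have [j je] := exists_inv_lt e0; have [n] := lo j (maxn N N1).
rewrite geq_max => /andP[Nn N1n] hn; exists n => //.
have [_ p0 _] := N1P n N1n; rewrite ltr_pdivlMr//; apply: lt_le_trans hn.
rewrite ltr_pM2r// mulrBl mul1r ltrBrDr addrC -ltrBrDr.
by move: je; rewrite ltr_pdivlMr.
Qed.

Lemma lil_half_limn_esup x s : 0 < s -> lil_half x s ->
  limn_esup (fun n => ((\sum_(i < n) x i) / phi n)%:E) = s%:E.
Proof.
move=> s0 h; have [up _] := h; apply/le_anti/andP; split.
- apply/lee_addgt0Pr => e e0.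
  have [j] := exists_inv_lt (divr_gt0 e0 s0); rewrite ltr_pdivlMr// => je.
  have [N0 N0P] := up j; have [N1 N1P] := lil_normalizer_large 0.
  apply: (@limn_esup_le _ _ (maxn N0 N1)) => n; rewrite geq_max => /andP[n0 n1].
  have [_ p0 _] := N1P n n1; rewrite -EFinD lee_fin ler_pdivrMr//.
  apply: le_trans (N0P n n0) _; rewrite ler_pM2r// mulrDl mul1r lerD2l.
  exact: ltW.
- apply/lee_addgt0Pr => e e0; rewrite -leeBlDr// -EFinB.
  apply: limn_esup_ge => N.
  have [|n Nn hn] := @lil_half_ge x s (s - e) h _ s0 N; first by rewrite ltrBlDr ltrDl.
  by exists n => //; rewrite lee_fin ltW.
Qed.

(* At an up-crossing of [q >= 0] the normalized sum overshoots [q] by at most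
   [M / phi n], because [phi] is nondecreasing. *)
Lemma lil_crossing x s (M q : R) : 0 < s -> (forall i, `|x i| <= M) ->
  lil_half x s -> lil_half (fun i => - x i) s -> 0 <= q < s ->
  seq_limit_point (fun n => (\sum_(i < n) x i) / phi n) q.
Proof.
move=> s0 xM hp hn /andP[q0 qs] j N.
pose Z (n : nat) := (\sum_(i < n) x i) / phi n.
have e0 : 0 < j.+1%:R^-1 :> R by rewrite invr_gt0 ltr0n.
have [N1 N1P] := lil_normalizer_large (M / j.+1%:R^-1).
have [n1] := @lil_half_ge (fun i => - x i) s 0 hn s0 s0 (maxn N N1).
rewrite geq_max => /andP[Nn1 N1n1]; rewrite sumrN mulNr oppr_gt0 => Zn1.
(* At [n1] the normalized sum is negative, hence below [q]; the first later index above [q] is thus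
   a genuine up-crossing, its predecessor being at most [q]. *)
have ex : exists n, (n1 <= n)%N && (q < Z n).
  by have [n n1n qn] := lil_half_ge hp qs s0 n1; exists n; rewrite n1n.
case: (ex_minnP ex) => -[|n] /andP[n1n qZ] nmin.
  by move: n1n Zn1 qZ; rewrite leqn0 => /eqP -> /ltW Z0 /lt_le_trans/(_ Z0); rewrite ltNge q0.
have {}n1n : (n1 <= n)%N.
  move: n1n; rewrite leq_eqVlt => /predU1P[e|//].
  by move: qZ; rewrite -e => /lt_trans/(_ Zn1); rewrite ltNge q0.
have Zn : Z n <= q.
  by rewrite leNgt; apply/negP => h; have := nmin n; rewrite n1n h ltnn => /(_ isT).
have [_ p0 pp] := N1P n (leq_trans N1n1 n1n).
have [pM p0' _] := N1P n.+1 (leq_trans N1n1 (leqW n1n)).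
exists n.+1; first by rewrite (leq_trans Nn1)// leqW.
rewrite -/(Z n.+1) gtr0_norm ?subr_gt0//; apply: (@le_lt_trans _ _ (M / phi n.+1)); last first.
  by rewrite ltr_pdivrMr// mulrC -ltr_pdivrMr.
rewrite lerBlDr /Z ler_pdivrMr// mulrDl divfK ?gt_eqF// big_ord_recr/= addrC lerD//.
  by rewrite (le_trans (ler_norm _)).
apply: (@le_trans _ _ (q * phi n)); last by rewrite ler_wpM2l.
by rewrite -ler_pdivrMr.
Qed.

End DeterministicSequences.

(** * Almost sure statements under each measure and the final assembly *)

Section AlmostSureLIL.
Context {R : realType} {d : measure_display} {T : measurableType d}.
Variables (P : probability T R) (X : nat -> T -> R) (s : R).
Hypothesis hX : forall n, inH (X n).
Hypothesis s0 : 0 < s.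
Hypothesis ng : nearly_gaussian P X s.

Lemma ae_lil_half : \forall w \ae P, lil_half (fun i => X i w) s.
Proof.
have jV j : 0 < j.+1%:R^-1 :> R by rewrite invr_gt0 ltr0n.
have up := ae_foralln (fun j => lil_upper hX s0 ng (jV j)).
have jV1 j : 0 < (j.+1%:R^-1 : R) <= 1 by rewrite jV invf_le1 ?ltr0n// ler1n.
have lo := ae_foralln (fun j => lil_lower hX s0 ng (jV1 j)).
by apply: filterS2 up lo => w up lo.
Qed.

End AlmostSureLIL.

Lemma probability_ae1 (R : realType) (d : measure_display) (T : measurableType d)
    (P : probability T R) (A : set T) :
  measurable A -> (\forall w \ae P, A w) -> P A = 1%E.
Proof.
move=> mA [B [mB PB AB]].
have PA0 : P (~` A) = 0%E.
  by apply/eqP; rewrite eq_le measure_ge0 andbT -PB le_measure ?inE//; exact: measurableC.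
by rewrite -[A]setCK probability_setC ?PA0 ?sube0//; exact: measurableC.
Qed.

Lemma lov_eq1 (R : realType) (d : measure_display) (T : measurableType d)
    (Ps : set (probability T R)) (A : set T) : Ps !=set0 -> measurable A ->
  (forall P, Ps P -> \forall w \ae P, A w) -> lov Ps A = 1%E.
Proof.
move=> [P0 PsP0] mA hA; rewrite /lov (_ : [set _ | _ in _] = [set 1%E]) ?ereal_inf1//.
apply/seteqP; split=> [_ [P PsP <-]|_ ->]; first by rewrite /= probability_ae1//; exact: hA.
by exists P0 => //; rewrite probability_ae1//; exact: hA.
Qed.

Theorem theorem1 (R : realType) (d : measure_display) (T : measurableType d)
  (Ps : set (probability T R)) (X : nat -> T -> R) (sigl sigu : R) :
  Ps !=set0 ->
  continuous_capacity (upV Ps) -> continuous_capacity (lov Ps) ->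
  (forall n, measurable_fun setT (X n)) ->
  (forall n, exists M : R, forall w, `|X n w| <= M) ->
  iid Ps X ->
  upE Ps (X 0) = 0%E -> loE Ps (X 0) = 0%E ->
  0 < sigl -> sigl <= sigu ->
  upE Ps (fun w => X 0 w ^+ 2) = (sigu ^+ 2)%:E ->
  loE Ps (fun w => X 0 w ^+ 2) = (sigl ^+ 2)%:E ->
  let Z := fun w n => lil_norm X n w in
  let LS := fun w => limn_esup (fun n => (Z w n)%:E) in
  let LI := fun w => limn_einf (fun n => (Z w n)%:E) in
  [/\ lov Ps [set w | (sigl%:E <= LS w <= sigu%:E)%E] = 1%E,
      lov Ps [set w | (- sigu%:E <= LI w <= - sigl%:E)%E] = 1%E &
      lov Ps [set w | [set r : R | cluster (Z w n @[n --> \oo]) r /\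
                               r%:E <> LS w /\ r%:E <> LI w]
                      = `]- sigl, sigl[%classic] = 1%E].
Proof.
move=> Ps0 cV _ mX bX iidX uE0 lE0 s0 slu uE2 lE2 Z LS LI.
have hX n : inH (X n) by split.
have hX2 n : inH (fun w => X n w ^+ 2) by exact: inHX.
(* The degeneracy result applied to the square function: the lower and upper variances coincide. *)
have eqs : sigl = sigu.
  have msq : measurable_fun setT (fun x : R => x ^+ 2) by exact: exprn_measurable.
  have /= := congr1 EFin (uE_linear Ps0 mX iidX cV msq hX2).
  rewrite -(loE_uE Ps0 (hX2 0%N)) -(upE_fineK Ps0 (hX2 0%N)).
  rewrite lE2 [X in _ = X]uE2 => -[] /eqP.
  by rewrite eqrXn2 ?ltW ?(lt_le_trans s0)// => /eqP.
move: slu uE2; rewrite -eqs => _ uE2; pose s := sigl.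
have mean_itv P f : Ps P -> inH f ->
    ((\int[P]_w f w)%:E <= upE Ps f /\ loE Ps f <= (\int[P]_w f w)%:E)%E.
  move=> PsP hf; rewrite -Exp_EFin//.
  by split; [apply: ereal_sup_ubound|apply: ereal_inf_lbound]; exists P.
have mean0 P : Ps P -> \int[P]_w X 0 w = 0.
  move=> /mean_itv/(_ (hX 0%N)); rewrite uE0 lE0 !lee_fin => -[h1 h2].
  by apply/le_anti; rewrite h1.
have var P : Ps P -> \int[P]_w (X 0 w ^+ 2) = s ^+ 2.
  move=> /mean_itv/(_ (hX2 0%N)); rewrite uE2 lE2 !lee_fin => -[h1 h2].
  by apply/le_anti; rewrite h1.
have ng P : Ps P -> nearly_gaussian P X s := peng_nearly_gaussian Ps0 mX bX iidX mean0 var (P := P).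
have [M XM] := bX 0%N.
have ae_good P : Ps P -> \forall w \ae P, [/\ lil_half (fun i => X i w) s,
    lil_half (fun i => - X i w) s & forall n, `|X n w| <= M].
  move=> PsP.
  apply: filterS3 (ae_lil_half hX s0 (ng P PsP))
    (ae_lil_half (fun n => inHN (hX n)) s0 (nearly_gaussian_opp (ng P PsP)))
    (ae_norm_le Ps0 mX iidX PsP XM) => w; by split.
have ZN w n : - Z w n = (\sum_(i < n) - X i w) / Num.sqrt (2 * n%:R * ln (ln n%:R)).
  by rewrite /Z /lil_norm sumrN mulNr.
have LSE w : lil_half (fun i => X i w) s -> LS w = s%:E.
  by move=> h; exact: (lil_half_limn_esup s0 h).
have LIE w : lil_half (fun i => - X i w) s -> LI w = (- s)%:E.
  move=> h; rewrite /LI limn_einf_opp EFinN; congr (- _)%E.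
  by under eq_fun do rewrite ZN; exact: (lil_half_limn_esup s0 h).
have lpE w (q : R) : lil_half (fun i => X i w) s -> lil_half (fun i => - X i w) s ->
    (forall n, `|X n w| <= M) -> - s < q < s -> seq_limit_point (Z w) q.
  (* The crossing argument needs a nonnegative level; negative levels are reached through -X. *)
  move=> h hN hM /andP[q1 q2]; have [q0|q0] := leP 0 q.
    by apply: (lil_crossing s0 hM h hN); rewrite q0.
  apply/seq_limit_point_opp; under eq_fun do rewrite ZN.
  apply: (lil_crossing (x := fun i => - X i w) s0 (M := M)) => //.
  - by move=> i; rewrite normrN.
  - by under eq_fun do rewrite opprK.
  - by rewrite oppr_ge0 (ltW q0) ltrNl.
have mZ n : measurable_fun setT (fun w => Z w n).
  rewrite /Z /lil_norm; apply: measurable_funM => //.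
  by have [] := inH_sum (index_enum 'I_n) (fun i : 'I_n => hX i).
have mZE n : measurable_fun setT (fun w => (Z w n)%:E) by exact/measurable_EFinP.
have mLS : measurable_fun setT LS by exact: (measurable_fun_limn_esup mZE).
have mLI : measurable_fun setT LI.
  rewrite /LI; under eq_fun do rewrite limn_einf_opp.
  apply: measurableT_comp => //.
  apply: (@measurable_fun_limn_esup _ _ _ _ (fun n w => (- Z w n)%:E)) => n.
  by apply/measurable_EFinP; exact: measurable_funN.
have mitv (f : T -> \bar R) a b : measurable_fun setT f ->
    measurable [set w | (a <= f w <= b)%E].
  move=> mf; rewrite (_ : [set w | _] = setT `&` f @^-1` [set` `[a, b]]).
    by apply: mf => //; exact: emeasurable_itv.
  by apply/seteqP; split => w /=; rewrite in_itv/= => // -[].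
have mlp (q : R) : measurable [set w | seq_limit_point (Z w) q].
  rewrite (_ : [set w | _] = \bigcap_(j : nat) \bigcap_(N : nat)
      \bigcup_(n in [set n | (N <= n)%N]) [set w | `|Z w n - q| < j.+1%:R^-1]).
    apply: bigcap_measurableType => j _; apply: bigcap_measurableType => N _.
    apply: bigcup_measurable => n _.
    have mb : measurable_fun setT (fun w => `|Z w n - q| < j.+1%:R^-1).
      apply: measurable_fun_ltr => //; apply: measurableT_comp => //.
      exact: measurable_funB.
    by rewrite -[X in measurable X]setTI; exact: mb.
  apply/seteqP; split => w /= h.
    by move=> j _ N _; have [n Nn hn] := h j N; exists n.
  by move=> j N; have [n Nn hn] := h j I N I; exists n.
split.
- apply: lov_eq1 => //; first exact: mitv.
  by move=> P PsP; apply: filterS (ae_good P PsP) => w [h _ _] /=; rewrite LSE// lexx.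
- apply: lov_eq1 => //; first exact: mitv.
  by move=> P PsP; apply: filterS (ae_good P PsP) => w [_ h _] /=; rewrite LIE// lexx.
(* By [limit_set_itv] the event is a countable Boolean combination of measurable sets. The range
   condition on the rational q is a set not depending on w, either everything or empty. *)
- rewrite (_ : [set w | _] = [set w | (s%:E <= LS w <= s%:E)%E] `&`
    [set w | ((- s)%:E <= LI w <= (- s)%:E)%E] `&`
    ~` \bigcup_(q : rat) ([set w | - s < ratr q < s] `&` ~` [set w | seq_limit_point (Z w) (ratr q)])).
    apply: lov_eq1 => //.
      apply: measurableI; first by apply: measurableI; exact: mitv.
      apply: measurableC; apply: bigcupT_measurable_rat => q.
      apply: measurableI; last exact: measurableC.
      have [h|h] := pselect (- s < ratr q < s).
        by rewrite (_ : [set w | _] = setT)//; apply/seteqP; split.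
      by rewrite (_ : [set w | _] = set0)//; apply/seteqP; split.
    move=> P PsP; apply: filterS (ae_good P PsP) => w [h hN hM].
    split; first by split; rewrite /= ?LSE ?LIE// lexx.
    by move=> [q _ [/= qs]]; apply; exact: lpE.
  apply/seteqP; split => w /=.
    move=> /(limit_set_itv (Z w) s0)[LSs LIs lp]; split.
      by rewrite /LS /LI LSs LIs; split; rewrite lexx.
    by move=> [q _ [/= qs]]; apply; exact: lp.
  move=> [[/le_anti LSs /le_anti LIs] lp]; apply/(limit_set_itv (Z w) s0).
  split=> [//|//|q qs]; apply: contrapT => nlp; apply: lp.
  by exists q.
Qed.
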